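(* Let $G_1=\langle X_1\mid R_1\rangle$ and $G_2=\langle X_2\mid R_2\rangle$ be groups with $X_1$, $X_2$ finite and $R_1$, $R_2$ not necessarily finite. Suppose that there exist proper subgroups $H_1<G_1$ and $H_2<G_2$ such that $\{1,w_1,w_1^2,\dots,w_1^{n_1-1}\}$ and $\{1,w_2,w_2^2,\dots,w_2^{n_2-1}\}$ are full sets of (right) coset representatives of $H_1$ in $G_1$ and of $H_2$ in $G_2$, respectively, for some $w_1\in G_1$, $w_2\in G_2$, where $n_1=[G_1:H_1]$ and $n_2=[G_2:H_2]$ are finite. Then the nerve complex $\mathcal{NC}(G_1\ast G_2,\mathscr H_{\mathrm{fi}})$ and the order complex $\Delta P_{\mathrm{fi}}(G_1\ast G_2)$ are contractible.
   Context: $G_1\ast G_2$ is the free product. For a group $G$: $\mathscr H_{\mathrm{fi}}$ is the set of all proper finite index subgroups of $G$, and $P_{\mathrm{fi}}(G)=\{Hg\mid H<G \text{ proper},\ [G:H]<\infty,\ g\in G\}$ is the set of all right cosets of such subgroups, partially ordered by inclusion. The order complex $\Delta P$ of a poset $P$ is the simplicial complex whose $n$-simplices are the chains $C_0\subset C_1\subset\dots\subset C_n$ in $P$. The nerve complex $\mathcal{NC}(G,\mathscr H)$ of $G$ with respect to a set $\mathscr H$ of subgroups is the simplicial complex with an $n$-simplex for every set $\{H_0g_0,\dots,H_ng_n\}$ of $n+1$ cosets with $H_i\in\mathscr H$, $g_i\in G$ and $H_0g_0\cap\dots\cap H_ng_n\ne\emptyset$. *)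

(* Defs.v *)
From HB Require Import structures.
From mathcomp Require Import all_boot all_order all_algebra.
From mathcomp Require Import all_classical all_reals all_analysis.
Import Order.TTheory GRing.Theory Num.Theory.
Import numFieldNormedType.Exports.

Set Implicit Arguments.
Unset Strict Implicit.
Unset Printing Implicit Defensive.

Local Open Scope classical_set_scope.
Local Open Scope quotient_scope.

Section WordGroup.
Variables (T : choiceType) (inv : T -> T) (E : seq T -> seq T -> Prop).

(* The congruence on the free monoid on [T] generated by [E] and by the
   relations making the letters [t] and [inv t] mutually inverse. *)
Inductive word_congr : seq T -> seq T -> Prop :=
| word_congr_rel u v : E u v -> word_congr u v
| word_congr_mulV t : word_congr [:: t; inv t] [::]
| word_congr_Vmul t : word_congr [:: inv t; t] [::]
| word_congr_refl u : word_congr u u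
| word_congr_sym u v : word_congr u v -> word_congr v u
| word_congr_trans v u w : word_congr u v -> word_congr v w -> word_congr u w
| word_congr_cat u u' v v' :
    word_congr u u' -> word_congr v v' -> word_congr (u ++ v) (u' ++ v').

Definition word_congrb : rel (seq T) := fun u v => `[< word_congr u v >].

Lemma word_congrb_is_equiv : equiv_class_of word_congrb.
Proof.
split.
- by move=> u; apply/asboolP; exact: word_congr_refl.
- by move=> u v; apply/asboolP/asboolP; exact: word_congr_sym.
- move=> v u w /asboolP uv /asboolP vw; apply/asboolP.
  exact: word_congr_trans uv vw.
Qed.

Canonical word_congr_equiv := EquivRelPack word_congrb_is_equiv.

Definition word_group := {eq_quot word_congr_equiv}.

HB.instance Definition _ := Choice.on word_group.

Definition word_class (u : seq T) : word_group := \pi_word_group u.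

Lemma word_classP u v : word_class u = word_class v <-> word_congr u v.
Proof. by split=> [/eqmodP/asboolP|?]; [|apply/eqmodP/asboolP]. Qed.

Lemma word_class_repr x : word_class (repr x) = x.
Proof. exact: reprK. Qed.

Definition word_mul (x y : word_group) : word_group :=
  word_class (repr x ++ repr y).
Definition word_inv (x : word_group) : word_group :=
  word_class (rev (map inv (repr x))).

Lemma word_mulE u v :
  word_mul (word_class u) (word_class v) = word_class (u ++ v).
Proof.
by apply/word_classP; apply: word_congr_cat; apply/word_classP;
  rewrite word_class_repr.
Qed.

Lemma word_mulA : associative word_mul.
Proof.
move=> x y z; rewrite -[x]word_class_repr -[y]word_class_repr.
by rewrite -[z]word_class_repr !word_mulE catA.
Qed.

Lemma word_1mul : left_id (word_class [::]) word_mul.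
Proof. by move=> x; rewrite -[x]word_class_repr word_mulE. Qed.

Lemma word_mul1 : right_id (word_class [::]) word_mul.
Proof. by move=> x; rewrite -[x]word_class_repr word_mulE cats0. Qed.

Lemma word_Vmul : left_inverse (word_class [::]) word_inv word_mul.
Proof.
move=> x; rewrite -[in X in word_mul _ X](word_class_repr x) word_mulE.
apply/word_classP; elim: (repr x) => [|t u IHu]; first exact: word_congr_refl.
rewrite /= rev_cons cat_rcons; apply: word_congr_trans IHu.
apply: word_congr_cat; first exact: word_congr_refl.
apply: (@word_congr_cat [:: inv t; t] [::]); last exact: word_congr_refl.
exact: word_congr_Vmul.
Qed.

Lemma word_mulV : right_inverse (word_class [::]) word_inv word_mul.
Proof.
move=> x; rewrite -[X in word_mul X _](word_class_repr x) word_mulE.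
apply/word_classP; elim: (repr x) => [|t u IHu]; first exact: word_congr_refl.
rewrite /= rev_cons -cats1 catA -cat_cons.
apply: word_congr_trans (word_congr_mulV t).
apply: (@word_congr_cat _ [:: t] [:: inv t]); last exact: word_congr_refl.
exact: (word_congr_cat (word_congr_refl [:: t]) IHu).
Qed.

HB.instance Definition _ := isGroup.Build word_group
  word_mulA word_1mul word_mul1 word_Vmul word_mulV.

End WordGroup.

(* Words in the generators and their inverses: [(x, true)] stands for [x] and
   [(x, false)] for [x^-1]. *)
Definition signed_word (X : choiceType) := seq (X * bool).

Definition presented_group (X : choiceType) (R : set (signed_word X)) :
    groupType :=
  @word_group (X * bool)%type (fun l => (l.1, ~~ l.2))
    (fun u v => R u /\ v = [::]).

Definition group_iso (G H : groupType) :=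
  exists f : {multiplicative G -> H}, bijective f.

(* The identities of [G1] and [G2] become trivial: [inl 1] is idempotent, and
   [word_group] makes every letter invertible. *)
Inductive free_product_rel (G1 G2 : groupType) :
    seq (G1 + G2) -> seq (G1 + G2) -> Prop :=
| free_product_rel_l (a b : G1) :
    free_product_rel [:: inl a; inl b] [:: inl (a * b)%g]
| free_product_rel_r (a b : G2) :
    free_product_rel [:: inr a; inr b] [:: inr (a * b)%g].

Definition free_product (G1 G2 : groupType) : groupType :=
  @word_group (G1 + G2)%type
    (fun t => match t with inl a => inl (a^-1)%g | inr b => inr (b^-1)%g end)
    (@free_product_rel G1 G2).

Section Cosets.
Variable G : groupType.
Implicit Types (H : set G) (Hs : set (set G)).

Definition is_subgroup H :=
  H 1%g /\ forall x y, H x -> H y -> H (x * y^-1)%g.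

Definition proper_subgroup H := is_subgroup H /\ H <> [set: G].

Definition right_coset H (g : G) : set G := [set (h * g)%g | h in H].

Definition right_cosets H : set (set G) :=
  [set right_coset H g | g in [set: G]].

Definition has_index H (n : nat) := (right_cosets H #= `I_n)%card.

Definition right_transversal H (T : set G) :=
  forall C, right_cosets H C -> exists! t, T t /\ C t.

Definition Hfi : set (set G) :=
  [set H | proper_subgroup H /\ exists n, has_index H n].

Definition cosets_of Hs : set (set G) :=
  [set C | exists2 H, Hs H & right_cosets H C].

End Cosets.

Arguments Hfi : clear implicits.

Definition Pfi (G : groupType) : set (set G) := cosets_of (Hfi G).

Arguments Pfi : clear implicits.

(* The vertices are the [v] such that [[set v]] is a simplex; other elements
   of [V] play no role. *)
Record simplicial_complex (V : choiceType) := SimplicialComplex {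
  simplex : set (set V);
  simplex_finite : forall s, simplex s -> finite_set s;
  simplex_neq0 : forall s, simplex s -> s !=set0;
  simplex_face : forall s t, simplex s -> t `<=` s -> t !=set0 -> simplex t
}.

Section OrderComplex.
Variables (V : choiceType) (le : V -> V -> Prop) (P : set V).

Definition order_simplex : set (set V) :=
  [set s | [/\ finite_set s, s !=set0, s `<=` P & total_on s le]].

Lemma order_simplex_face s t :
  order_simplex s -> t `<=` s -> t !=set0 -> order_simplex t.
Proof.
move=> [sfin _ sP stot] ts t0; split=> //; first exact: sub_finite_set sfin.
- exact: subset_trans sP.
- by move=> x y /ts sx /ts sy; exact: stot.
Qed.

(* [le] is meant to be an order relation on [P]. *)
Definition order_complex : simplicial_complex V.
Proof.
by apply: (@SimplicialComplex _ order_simplex _ _ order_simplex_face) => s [].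
Defined.

End OrderComplex.

Section NerveComplex.
Variables (G : groupType) (Hs : set (set G)).

Definition nerve_simplex : set (set (set G)) :=
  [set s | [/\ finite_set s, s !=set0, s `<=` cosets_of Hs &
               \bigcap_(C in s) C !=set0]].

Lemma nerve_simplex_face s t :
  nerve_simplex s -> t `<=` s -> t !=set0 -> nerve_simplex t.
Proof.
move=> [sfin _ sP [g sg]] ts t0; split=> //; first exact: sub_finite_set sfin.
- exact: subset_trans sP.
- by exists g => C /ts; exact: sg.
Qed.

Definition nerve_complex : simplicial_complex (set G).
Proof.
by apply: (@SimplicialComplex _ nerve_simplex _ _ nerve_simplex_face) => s [].
Defined.

End NerveComplex.

Section Realization.
Variables (R : realType) (V : choiceType) (K : simplicial_complex V).
Local Open Scope ring_scope.

(* Barycentric coordinates; the sum is over the finite support of [x]. *)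
Record realization := Realization {
  bary : V -> R;
  bary_ge0 : forall v, 0 <= bary v;
  bary_supp : simplex K [set v | bary v != 0];
  bary_sum : \sum_(v \in [set: V]) bary v = 1
}.

HB.instance Definition _ := gen_eqMixin realization.
HB.instance Definition _ := gen_choiceMixin realization.

Definition closed_simplex (s : set V) : set realization :=
  [set x | [set v | bary x v != 0] `<=` s].

(* [U] is open when its trace on every closed simplex is open for the
   Euclidean topology of that simplex. *)
Definition realization_open : set (set realization) :=
  [set U | forall s x, simplex K s -> closed_simplex s x -> U x ->
     exists2 e : R, 0 < e & forall y, closed_simplex s y ->
       (forall v, `|bary x v - bary y v| < e) -> U y].

Lemma realization_openT : realization_open setT.
Proof. by move=> s x _ _ _; exists 1. Qed.

Lemma realization_openI : setI_closed realization_open.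
Proof.
move=> A B oA oB s x Ks sx [Ax Bx].
have [d d0 dA] := oA s x Ks sx Ax; have [e e0 eB] := oB s x Ks sx Bx.
exists (Num.min d e); first by rewrite lt_min d0.
move=> y sy xy; split.
- by apply: dA => // v; move: (xy v); rewrite lt_min => /andP[].
- by apply: eB => // v; move: (xy v); rewrite lt_min => /andP[].
Qed.

Lemma realization_open_bigU (I : Type) (f : I -> set realization) :
  (forall i, realization_open (f i)) -> realization_open (\bigcup_i f i).
Proof.
move=> of_ s x Ks sx [i _ fix_]; have [e e0 ef] := of_ i s x Ks sx fix_.
by exists e => // y sy xy; exists i => //; exact: ef.
Qed.

HB.instance Definition _ := isOpenTopological.Build realization
  realization_openT realization_openI realization_open_bigU.

End Realization.

Definition contractible (R : realType) (X : topologicalType) :=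
  exists (x0 : X) (F : X * R -> X),
    [/\ {within [set p : X * R | p.2 \in `[0%R, 1%R]], continuous F},
        forall x, F (x, 0%R) = x &
        forall x, F (x, 1%R) = x0].

(* Main.v *)
Require Import Defs.
From mathcomp Require Import all_boot all_order all_algebra.
From mathcomp Require Import all_classical all_reals all_analysis.
From mathcomp Require Import finmap ring lra zify.
Import Order.TTheory GRing.Theory Num.Theory.
Import numFieldNormedType.Exports.

Set Implicit Arguments.
Unset Strict Implicit.
Unset Printing Implicit Defensive.

Local Open Scope classical_set_scope.

(** Write [G] for the free product.  The engine is a cone construction.  Let [M]
    be a finite index subgroup of [G], and let [K] be a proper finite index
    subgroup that meets every coset of [M].  If finitely many cosets, each a
    union of cosets of [M], have a common point [g], then they all contain
    [M g], hence a point of [K].  So the subcomplex of the nerve spanned by such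
    cosets lies in a cone with apex [K].

    To find [K] ([fp_coprime_complement]), recall that two subgroups of coprime
    indices always meet each other's cosets ([coprime_transitive]).  It is thus
    enough to have [G] act transitively on a finite set with more than one point
    and of cardinality prime to the index [m] of [M].  Such a set is a chain of
    [2 m] blocks of [n1] and [n2] points in alternation, each sharing one point
    with the next: [G1] acts on each block of [n1] points as on the cosets of
    [H1], [G2] acts on each block of [n2] points as on the cosets of [H2], and
    both fix the other points ([fp_transitive_action]).  The chain has
    [1 + m (n1 + n2 - 2)] points.

    As [G] is finitely generated, it has countably many finite index subgroups
    ([fin_generated_Hfi_countable]).  One can therefore choose a decreasing
    sequence of finite index subgroups [M_k], with subgroups [K_k] as above,
    such that [M_(k+1)] lies in [K_k] and every finite index subgroup contains
    some [M_k].  Let the level of a coset be the least [k] such that it is a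
    union of cosets of [M_k].  Then the simplices with vertices of level at most
    [k] can be coned off by [K_k], a vertex of level at most [k + 1].  This
    suffices for an explicit contraction ([flow_contraction]): the vertices of
    level [k] travel to [K_k] during the [k]-th of a sequence of time intervals
    that accumulate at time zero, so that higher levels move first and each
    point rests for a while.  At any time only one level travels, the lower
    levels have not moved and the higher levels have reached their apices; these
    vertices span a simplex.  All the apices [K_k] finally collapse to [K_0].

    A chain of cosets is a simplex of the nerve, which embeds the order complex
    in the nerve.  A variant of barycentric subdivision maps the nerve back,
    sending each point of a simplex to a combination of nested intersections of
    its vertices ([cap_coord_supp]).  A point of the order complex is joined to
    its image under the composite by a segment ([chain_cap]), after which the
    image of the contraction of the nerve takes over ([slide_contraction]).

    For the continuity of all these maps on the product with an interval, it is
    enough that the barycentric coordinates be continuous on each closed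
    simplex and that the image of a closed simplex lie in a finite subcomplex
    ([finitary_continuous]). *)

(** * Continuity of maps between realizations *)

Section SimplexNbhs.
Variables (R : realType) (V : choiceType) (K : simplicial_complex V).
Local Open Scope ring_scope.

(** The neighborhoods within [s]: a set is open in the realization when it
    belongs to this filter for each of its points [x] and each simplex [s]
    containing [x]. *)
Definition simplex_nbhs (s : set V) (x : realization R K) :
    set_system (realization R K) :=
  [set A | exists2 e : R, 0 < e & forall y, closed_simplex s y ->
     (forall v, `|bary x v - bary y v| < e) -> A y].

Global Instance simplex_nbhs_filter s x : Filter (simplex_nbhs s x).
Proof.
split; first by exists 1.
- move=> A B [d d0 dA] [e e0 eB]; exists (Num.min d e).
    by rewrite lt_min d0.
  move=> y sy xy; split.
  + by apply: dA => // v; move: (xy v); rewrite lt_min => /andP[].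
  + by apply: eB => // v; move: (xy v); rewrite lt_min => /andP[].
- by move=> A B AB [d d0 dA]; exists d => // y sy xy; exact/AB/dA.
Qed.

Lemma simplex_nbhs_refl s x A : closed_simplex s x -> simplex_nbhs s x A -> A x.
Proof. by move=> sx [e e0]; apply=> // v; rewrite subrr normr0. Qed.

Lemma simplex_nbhs_closed s x : simplex_nbhs s x (closed_simplex s).
Proof. by exists 1. Qed.

Lemma cvg_bary s x v : (fun y => bary y v) @ simplex_nbhs s x --> bary x v.
Proof.
apply/cvgrPdist_lt => e e0; exists e => // y _; exact.
Qed.

Lemma finite_supp (x : realization R K) : finite_set [set v | bary x v != 0].
Proof. exact: simplex_finite (bary_supp x). Qed.

Lemma realization_eqP (x y : realization R K) :
  (forall v, bary x v = bary y v) -> x = y.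
Proof.
case: x y => [f f0 fs f1] [g g0 gs g1] /= fg.
have {fg} fg : f = g by apply/funext.
by subst g; congr Realization; exact: Prop_irrelevance.
Qed.

(** The finitely many nonzero coordinates of [x] are bounded away from zero. *)
Lemma supp_stable s x :
  simplex_nbhs s x [set y | forall v, bary x v != 0 -> bary y v != 0].
Proof.
have /finite_seqP[l lE] := finite_supp x.
have [e e0 le] : exists2 e : R, 0 < e & forall v, v \in l -> e <= bary x v.
  have : forall v, v \in l -> 0 < bary x v.
    move=> v vl; rewrite lt0r bary_ge0 andbT.
    by have : [set` l] v by []; rewrite -lE.
  elim: l {lE} => [|a l IH] H; first by exists 1.
  have [e e0 He] := IH (fun v vl => H v (mem_behead (s := a :: l) vl)).
  exists (Num.min e (bary x a)); first by rewrite lt_min e0 H ?mem_head.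
  move=> v; rewrite inE => /orP[/eqP ->|/He ev]; rewrite ge_min ?lexx ?orbT //.
  by rewrite ev.
exists e => // y sy xy v xv; apply/eqP => yv.
have /le : v \in l by have : [set v | bary x v != 0] v by []; rewrite lE.
move: (xy v); rewrite yv subr0 ger0_norm ?bary_ge0 // => /lt_le_trans/[apply].
by rewrite ltxx.
Qed.

(** The topology of the realization is the metric one not only on closed
    simplices but on every finite subcomplex: a point near [x] has a support
    containing that of [x], and there are only finitely many such supports. *)
Lemma open_simplex_nbhs (U : set (realization R K)) (l : seq V) x :
  open U -> U x -> simplex_nbhs [set` l] x U.
Proof.
move=> oU Ux.
pose supp (y : realization R K) := [set v | bary y v != 0].
(* The masks [m] enumerate the possible supports within [l]. *)
have H (m : (size l).-tuple bool) :
    simplex_nbhs [set` l] x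
      [set y | supp x `<=` supp y -> supp y = [set` mask m l] -> U y].
  have [[y0 [xy0 y0m]]|N] := pselect (exists y0, supp x `<=` supp y0 /\
      supp y0 = [set` mask m l]).
    have [e e0 He] := oU (supp y0) x (bary_supp y0) xy0 Ux.
    by exists e => // y ly xy sxy sy; apply: He => //; rewrite y0m -sy.
  by exists 1 => // y _ _ xy ym; exfalso; apply: N; exists y.
have FF : Filter (simplex_nbhs [set` l] x) by exact: simplex_nbhs_filter.
have Hall := filter_forall FF H.
apply: filterS (filterI (filterI Hall (supp_stable _ _))
  (simplex_nbhs_closed _ _)) => y [[Hy xy] yl].
have mE : supp y = [set` mask [seq `[< supp y v >] | v <- l] l].
  rewrite -filter_mask; apply/seteqP; split => v /=.
    move=> yv; rewrite mem_filter.
    by apply/andP; split; [apply/asboolP|exact: yl].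
  by rewrite mem_filter => /andP[/asboolP].
have sz : size [seq `[< supp y v >] | v <- l] == size l by rewrite size_map.
exact: (Hy (Tuple sz)).
Qed.

End SimplexNbhs.

Section FinitaryContinuous.
Variables (R : realType) (V : choiceType) (K : simplicial_complex V).
Local Open Scope ring_scope.

(** The families of functions that are continuous on each closed simplex, with
    values in a finite-dimensional space there; [F x t] lists the barycentric
    coordinates of the image of [x] at time [t]. *)
Definition finitary (W : choiceType) (F : realization R K -> R -> W -> R) :=
  forall s, simplex K s ->
    (exists l : seq W, forall x t c, closed_simplex s x -> F x t c != 0 ->
       c \in l) /\
    forall x t c, closed_simplex s x ->
      (fun p => F p.1 p.2 c) @ filter_prod (simplex_nbhs s x) (nbhs t)
        --> F x t c.

Lemma finitary_uniform (W : choiceType) (F : realization R K -> R -> W -> R)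
    s x t e :
  finitary F -> simplex K s -> closed_simplex s x -> 0 < e ->
  \forall p \near filter_prod (simplex_nbhs s x) (nbhs t),
    forall c, `|F x t c - F p.1 p.2 c| < e.
Proof.
move=> fF Ks sx e0; have [[l ls] Fc] := fF s Ks.
have clo : \forall p \near filter_prod (simplex_nbhs s x) (nbhs t),
    closed_simplex s p.1.
  by apply: cvg_fst; exact: simplex_nbhs_closed.
have Hl : \forall p \near filter_prod (simplex_nbhs s x) (nbhs t),
    forall c, c \in l -> `|F x t c - F p.1 p.2 c| < e.
  elim: (l) => [|a l' IH]; first by near=> p.
  have /cvgrPdist_lt/(_ e e0) Ha := Fc x t a sx.
  near=> p => c; rewrite inE => /orP[/eqP->|cl'].
    by near: p.
  by move: c cl'; near: p.
near=> p => c; have [cl|cl] := boolP (c \in l).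
  by move: c cl; near: p.
have [->|/(ls _ _ _ sx)] := eqVneq (F x t c) 0; last by rewrite (negPf cl).
have [->|Fp] := eqVneq (F p.1 p.2 c) 0; first by rewrite subrr normr0.
have sp : closed_simplex s p.1 by near: p.
by move: (ls _ _ _ sp Fp); rewrite (negPf cl).
Unshelve. all: by end_near. Qed.

(** The tube lemma: since a closed bounded interval is compact, the points [x]
    such that the whole of [{x} x interval] is sent into an open set form an
    open set of the weak topology. *)
Lemma finitary_continuous (W : choiceType) (L : simplicial_complex W)
    (F : realization R K -> R -> realization R L) :
  finitary (fun x t => bary (F x t)) -> continuous (fun p => F p.1 p.2).
Proof.
move=> fF [x0 t0] A /=; rewrite {1}nbhsE => -[U [oU Ux] UA].
have near_U s x t : simplex K s -> closed_simplex s x -> U (F x t) ->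
    \forall p \near filter_prod (simplex_nbhs s x) (nbhs t), U (F p.1 p.2).
  move=> Ks sx Uxt; have [[l ls] _] := fF s Ks.
  have [e e0 He] := open_simplex_nbhs l oU Uxt.
  have clo : \forall p \near filter_prod (simplex_nbhs s x) (nbhs t),
      closed_simplex s p.1.
    by apply: cvg_fst; exact: simplex_nbhs_closed.
  have unif := finitary_uniform t fF Ks sx e0.
  near=> p; apply: He.
    by move=> c; apply: ls; near: p.
  by near: p.
have sx0 : closed_simplex [set v | bary x0 v != 0] x0 by [].
have [[/= P Q] [Px0 Qt0] PQ] := near_U _ _ _ (bary_supp x0) sx0 Ux.
have Px0' := simplex_nbhs_refl sx0 Px0.
have [d /= d0 dQ] := Qt0.
pose J : set R := `[t0 - d / 2, t0 + d / 2]%classic.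
have UJ t : J t -> U (F x0 t).
  rewrite /J /= in_itv /= => /andP[t1 t2]; apply: (PQ (x0, t)); split => //=.
  apply: dQ => /=; rewrite distrC ltr_norml; apply/andP; split; lra.
pose N := [set x : realization R K | forall t, J t -> U (F x t)].
have oN : open N.
  move=> s x Ks sx Nx.
  have cJ : compact J by exact: segment_compact.
  move/compact_near_coveringP: cJ => cov.
  apply: (cov _ (simplex_nbhs s x) (fun y t => U (F y t))) => t Jt.
  have := near_U s x t Ks sx (Nx t Jt).
  case=> -[/= A1 A2] [A1x A2t] A12; exists (A2, A1) => //= -[a b] [/= a1 b1].
  exact: (A12 (b, a)).
exists (N, J); last by move=> [x t] [/= Nx Jt]; exact/UA/Nx.
split => /=; first by apply: open_nbhs_nbhs; split.
exists (d / 2) => /=; first by lra.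
move=> t /=; rewrite ltr_norml => /andP[t1 t2].
by rewrite /J /= in_itv /=; apply/andP; split; lra.
Unshelve. all: by end_near. Qed.

End FinitaryContinuous.

(** * Contractions given in barycentric coordinates *)

Section Contraction.
Variables (R : realType) (V : choiceType) (K : simplicial_complex V).
Local Open Scope ring_scope.

(** Contractions are kept in this form, with coordinates under control, because
    that of the nerve is composed below with further maps. *)
Definition finitary_contraction (F : realization R K -> R -> realization R K)
    (x0 : realization R K) :=
  [/\ finitary (fun x t => bary (F x t)), forall x, F x 0 = x &
      forall x, F x 1 = x0].

Lemma finitary_contractible F x0 :
  finitary_contraction F x0 -> contractible R (realization R K).
Proof.
move=> [fF F0 F1]; exists x0, (fun p => F p.1 p.2); split=> //.
by apply: continuous_subspaceT; exact: finitary_continuous.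
Qed.

Lemma bary_neq0_ex (x : realization R K) : exists v, bary x v != 0.
Proof. by have [v] := simplex_neq0 (bary_supp x); exists v. Qed.

Lemma supp_fset (x : realization R K) :
  exists A : {fset V}, closed_simplex [set` A] x.
Proof.
by have /finite_fsetP[A AE] := finite_supp x; exists A => w; rewrite -AE.
Qed.

Lemma sum_bary (A : {fset V}) (x : realization R K) :
  closed_simplex [set` A] x -> \sum_(w <- A) bary x w = 1.
Proof.
move=> xA; rewrite -(bary_sum x); apply/esym/fsbigTE => w wA.
by apply: contraNeq wA => /xA.
Qed.

Lemma bary_le1 (x : realization R K) w : bary x w <= 1.
Proof.
have [A xA] := supp_fset x; rewrite -(sum_bary xA).
have [wA|wA] := boolP (w \in A).
  rewrite (bigD1_seq w) ?fset_uniq //= lerDl.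
  by apply: sumr_ge0 => u _; exact: bary_ge0.
have -> : bary x w = 0 by apply: contraNeq wA => /xA.
by apply: sumr_ge0 => u _; exact: bary_ge0.
Qed.

End Contraction.

Section Clamp.
Variable R : realType.
Local Open Scope ring_scope.

(** Homotopies are defined for all real times: clamping makes them stationary
    outside the unit interval. *)
Definition clamp (t : R) : R := Num.max 0 (Num.min 1 t).

Lemma clamp_ge0 t : 0 <= clamp t. Proof. by rewrite le_max lexx. Qed.
Lemma clamp_le1 t : clamp t <= 1.
Proof. by rewrite ge_max ler01 ge_min lexx. Qed.
Lemma clamp_le0 t : t <= 0 -> clamp t = 0.
Proof. by move=> t0; apply/max_idPl; rewrite ge_min t0 orbT. Qed.
Lemma clamp_ge1 t : 1 <= t -> clamp t = 1.
Proof. by move=> t1; rewrite /clamp (min_idPl t1); apply/max_idPr. Qed.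
Lemma clamp_neq0 t : clamp t != 0 -> 0 < t.
Proof. by apply: contraNT; rewrite -leNgt => /clamp_le0 ->. Qed.

Lemma clamp_continuous : continuous clamp.
Proof.
move=> t; apply: (@continuous_max R R (cst 0) (fun t : R => Num.min 1 t)).
  exact: cvg_cst.
apply: (@continuous_min R R (cst 1) id); first exact: cvg_cst.
exact: cvg_id.
Qed.

Lemma cvg_clamp (T : Type) (F : set_system T) {FF : Filter F} (f : T -> R) a :
  f @ F --> a -> clamp (f x) @[x --> F] --> clamp a.
Proof. by move=> fa; apply: continuous_cvg => //; exact: clamp_continuous. Qed.

End Clamp.

(** * Cones along a sequence of vertices *)

Section ConeSequence.
Variables (R : realType) (V : choiceType) (K : simplicial_complex V).
Variables (lev : V -> nat) (v : nat -> V).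
Local Open Scope ring_scope.

Hypothesis cone_simplex : forall k s, simplex K s ->
  (forall w, s w -> (lev w <= k)%N) -> simplex K (s `|` [set v k]).
Hypothesis lev_v : forall k, (lev (v k) <= k.+1)%N.
Hypothesis simplex_v0 : simplex K [set v 0%N].

Lemma apices_simplex n : simplex K [set v j | j in `I_n.+1].
Proof.
elim: n => [|n IHn].
  suff -> : [set v j | j in `I_1] = [set v 0%N] by [].
  by rewrite II1 image_set1.
rewrite IIS image_setU image_set1; apply: cone_simplex => // w [j /= jn <-].
exact: leq_trans (lev_v j) jn.
Qed.

(** The vertices that carry a point of [s] while level [k] travels, [L] being
    the highest level in [s]. *)
Definition cone_set s k L : set V :=
  [set w | s w /\ (lev w <= k)%N] `|`
  [set v j | j in [set j | (k <= j <= L)%N]].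

Lemma cone_set_simplex s k L :
  simplex K s -> (k <= L)%N -> simplex K (cone_set s k L).
Proof.
move=> Ks kL; rewrite -(subnKC kL); elim: (L - k)%N => [|n IHn] {L kL}.
  rewrite addn0 /cone_set.
  have -> : [set j | (k <= j <= k)%N] = [set k].
    apply/seteqP; split=> j /=; first by rewrite -eqn_leq => /eqP.
    by move=> ->; rewrite leqnn.
  rewrite image_set1.
  have [[w [sw wk]]|N] := pselect (exists w, s w /\ (lev w <= k)%N).
    apply: cone_simplex => [|u [] //]; apply: simplex_face Ks _ _ => [u []//|].
    by exists w.
  apply: simplex_face (apices_simplex k) _ _ => [u [su|->]|].
  - by exfalso; apply: N; exists u.
  - by exists k => //=.
  - by exists (v k); right.
have -> : cone_set s k (k + n.+1) =
    cone_set s k (k + n) `|` [set v (k + n.+1)%N].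
  rewrite /cone_set -setUA -image_set1 -image_setU; congr (_ `|` v @` _).
  apply/seteqP; split=> j /=; last by move=> [|->]; lia.
  move=> kj; have [->|jn] := eqVneq j (k + n.+1)%N; first by right.
  by left; lia.
apply: cone_simplex => // w [[_ wk]|[j /= jn <-]]; first lia.
by have := lev_v j; lia.
Qed.

(** The progress of level [k], which travels while [2 ^ (k + 2) t] is between
    1 and 2; these time intervals do not overlap, and precede the interval
    [[1/2, 1]] in which [last_stage] runs. *)
Definition stage k (t : R) : R := clamp (2 ^+ k.+2 * t - 1).
Definition last_stage (t : R) : R := clamp (2 * t - 1).

Lemma stage_ge0 k t : 0 <= stage k t. Proof. exact: clamp_ge0. Qed.
Lemma stage_le1 k t : stage k t <= 1. Proof. exact: clamp_le1. Qed.
Lemma last_stage_ge0 t : 0 <= last_stage t. Proof. exact: clamp_ge0. Qed.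
Lemma last_stage_le1 t : last_stage t <= 1. Proof. exact: clamp_le1. Qed.

Lemma stage_next j k t : (j < k)%N -> stage j t != 0 -> stage k t = 1.
Proof.
move=> jk /clamp_neq0; rewrite subr_gt0 => jt; apply: clamp_ge1.
rewrite lerBrDr; have t0 : 0 < t.
  by move: (lt_trans ltr01 jt); rewrite pmulr_rgt0 // exprn_gt0.
apply: (@le_trans _ _ (2 ^+ j.+3 * t)); last first.
  by rewrite ler_pM2r // ler_weXn2l ?ler1n.
by rewrite exprS -mulrA; lra.
Qed.

Lemma last_stage_stage t k : last_stage t != 0 -> stage k t = 1.
Proof.
move=> /clamp_neq0 t1; apply: clamp_ge1.
have : 4 * t <= 2 ^+ k.+2 * t.
  rewrite ler_pM2r; last by lra.
  by rewrite (_ : 4 = 2 ^+ 2) ?ler_weXn2l ?ler1n // expr2; lra.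
lra.
Qed.

Lemma stage0 k : stage k 0 = 0.
Proof. by apply: clamp_le0; rewrite mulr0; lra. Qed.

Lemma last_stage1 : last_stage 1 = 1.
Proof. by apply: clamp_ge1; lra. Qed.

(** The coordinate at [c] of the image of the vertex [w] at time [t]; the flow
    extends this affinely to simplices. *)
Definition travel (w : V) (t : R) (c : V) : R :=
  (1 - stage (lev w) t) * (w == c)%:R
  + stage (lev w) t * ((1 - last_stage t) * (v (lev w) == c)%:R
                       + last_stage t * (v 0%N == c)%:R).

Lemma travel_ge0 w t c : 0 <= travel w t c.
Proof.
have [s0 s1 l0 l1] := And4 (stage_ge0 (lev w) t) (stage_le1 (lev w) t)
  (last_stage_ge0 t) (last_stage_le1 t).
rewrite addr_ge0 ?mulr_ge0 ?ler0n ?subr_ge0 //.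
by rewrite addr_ge0 ?mulr_ge0 ?ler0n ?subr_ge0.
Qed.

Lemma travel_neq0 w t c : travel w t c != 0 ->
  [\/ c = w /\ stage (lev w) t != 1, c = v (lev w) /\ stage (lev w) t != 0 |
      c = v 0%N /\ last_stage t != 0].
Proof.
rewrite /travel; have [vc|vc] := eqVneq (v (lev w)) c.
  have [->|s0] := eqVneq (stage (lev w) t) 0; last first.
    by move=> _; apply: Or32; rewrite vc.
  have [->|wc] := eqVneq w c; last by rewrite mulr0 mul0r addr0 eqxx.
  by move=> _; apply: Or31; rewrite eq_sym oner_eq0.
rewrite mulr0 add0r; have [wc|wc] := eqVneq w c.
  have [->|s1] := eqVneq (stage (lev w) t) 1; last first.
    by move=> _; apply: Or31; rewrite wc.
  rewrite subrr mul0r add0r mul1r mulf_eq0 negb_or => /andP[l0].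
  by case: (v 0%N =P c) => [<- _|_]; [exact: Or33|rewrite eqxx].
rewrite /= mulr0 add0r !mulf_eq0 !negb_or => /and3P[_ l0].
by case: (v 0%N =P c) => [<- _|_]; [exact: Or33|rewrite eqxx].
Qed.

Lemma sum_delta (l : seq V) (f : V -> R) c : uniq l -> c \in l ->
  \sum_(w <- l) f w * (w == c)%:R = f c.
Proof.
move=> ul cl; rewrite (bigD1_seq c) //= eqxx mulr1 big1 ?addr0 // => w wc.
by rewrite (negPf wc) mulr0.
Qed.

Lemma travel0 w c : travel w 0 c = (w == c)%:R.
Proof. by rewrite /travel stage0 subr0 mul1r mul0r addr0. Qed.

Lemma travel1 w c : travel w 1 c = (v 0%N == c)%:R.
Proof.
have l1 : last_stage 1 != 0 by rewrite last_stage1 oner_eq0.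
rewrite /travel last_stage1 (last_stage_stage _ l1).
by rewrite !subrr !mul0r !mul1r !add0r.
Qed.

Lemma travel_continuous w c : continuous (fun t => travel w t c).
Proof.
have cs : continuous (stage (lev w)).
  move=> t; apply: cvg_clamp; apply: cvgB; last exact: cvg_cst.
  by apply: cvgM; [exact: cvg_cst|exact: cvg_id].
have cl : continuous last_stage.
  move=> t; apply: cvg_clamp; apply: cvgB; last exact: cvg_cst.
  by apply: cvgM; [exact: cvg_cst|exact: cvg_id].
move=> t; apply: cvgD; apply: cvgM; try exact: cvg_cst; try exact: cs.
  by apply: cvgB; [exact: cvg_cst|exact: cs].
apply: cvgD; apply: cvgM; try exact: cvg_cst; try exact: cl.
by apply: cvgB; [exact: cvg_cst|exact: cl].
Qed.

(** The travelling level, if there is one, is the least [k] with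
    [stage k t != 0]: by [stage_next], the levels above [k] have arrived. *)
Lemma travel_supp_simplex s t : simplex K s ->
  exists2 s', simplex K s' &
    forall w c, s w -> travel w t c != 0 -> s' c.
Proof.
move=> Ks; have /finite_seqP[l lE] := simplex_finite Ks.
pose L := \max_(w <- l) lev w.
have levL w : s w -> (lev w <= L)%N.
  by rewrite lE => /= wl; exact: leq_bigmax_seq.
have [ex|N] := pselect (exists k, (k <= L)%N && (stage k t != 0)); last first.
  have st0 w : s w -> stage (lev w) t = 0.
    move=> sw; apply/eqP; apply: contra_notT N => s0.
    by exists (lev w); rewrite levL.
  exists s => // w c sw /travel_neq0[[->]//|[_]|[_ l0]].
    by rewrite st0 ?eqxx.
  move: (last_stage_stage (lev w) l0); rewrite st0 // => /esym/eqP.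
  by rewrite oner_eq0.
case: (ex_minnP ex) => k /andP[kL sk0] kmin.
exists (cone_set s k L); first exact: cone_set_simplex.
move=> w c sw /travel_neq0[[-> s1]|[-> s0]|[-> l0]].
- left; split=> //; rewrite leqNgt; apply: contra s1 => klt.
  by rewrite (stage_next klt sk0).
- right; exists (lev w) => //=; rewrite levL // andbT; apply: kmin.
  by rewrite levL.
- right; exists 0%N => //=; rewrite andbT; apply: kmin.
  by rewrite (last_stage_stage _ l0) oner_eq0.
Qed.

Definition flow_coord (x : realization R K) (t : R) (c : V) : R :=
  \sum_(w \in [set: V]) bary x w * travel w t c.

Lemma flow_coordE (A : {fset V}) x t c : closed_simplex [set` A] x ->
  flow_coord x t c = \sum_(w <- A) bary x w * travel w t c.
Proof.
move=> xA; apply: fsbigTE => w wA; have [->|/xA] := eqVneq (bary x w) 0.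
  by rewrite mul0r.
by rewrite /= (negPf wA).
Qed.

Lemma flow_coord_neq0 x t c : flow_coord x t c != 0 ->
  exists2 w, bary x w != 0 & travel w t c != 0.
Proof.
have [A xA] := supp_fset x; rewrite (flow_coordE _ _ xA) => H.
apply: contrapT => N; case/eqP: H; apply: big1_seq => w _.
have [->|bw] := eqVneq (bary x w) 0; first by rewrite mul0r.
have [->|tw] := eqVneq (travel w t c) 0; first by rewrite mulr0.
by exfalso; apply: N; exists w.
Qed.

Lemma flow_coord_ge0 x t c : 0 <= flow_coord x t c.
Proof. by apply: fsumr_ge0 => w _; rewrite mulr_ge0 ?bary_ge0 ?travel_ge0. Qed.

Definition targets (A : {fset V}) : {fset V} :=
  (A `|` [fset v (lev w) | w in A] `|` [fset v 0%N])%fset.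

Lemma travel_targets (A : {fset V}) w t c :
  w \in A -> travel w t c != 0 -> c \in targets A.
Proof.
move=> wA /travel_neq0[[-> _]|[-> _]|[-> _]]; rewrite !inE ?wA ?eqxx ?orbT //.
by rewrite in_imfset ?orbT.
Qed.

Lemma sum_travel (A : {fset V}) w t : w \in A ->
  \sum_(c <- targets A) travel w t c = 1.
Proof.
move=> wA; have sd u : u \in targets A ->
    \sum_(c <- targets A) (u == c)%:R = 1 :> R.
  move=> uA; rewrite -[RHS](sum_delta (fun=> 1) (fset_uniq (targets A)) uA).
  by apply: eq_bigr => c _; rewrite mul1r eq_sym.
rewrite big_split /= -!mulr_sumr big_split /= -!mulr_sumr.
rewrite !sd ?inE ?wA ?eqxx ?orbT //.
  by ring.
by rewrite in_imfset ?orbT.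
Qed.

Lemma flow_coord_sum x t : \sum_(c \in [set: V]) flow_coord x t c = 1.
Proof.
have [A xA] := supp_fset x.
rewrite (fsbigTE (targets A)) => [|c cA]; last first.
  apply: contraNeq cA => /flow_coord_neq0[w xw].
  by apply: travel_targets; exact: xA.
under eq_bigr do rewrite (flow_coordE _ _ xA).
rewrite exchange_big /= -(sum_bary xA); apply: eq_big_seq => w wA.
by rewrite -mulr_sumr sum_travel ?mulr1.
Qed.

Lemma flow_coord_supp x t : simplex K [set c | flow_coord x t c != 0].
Proof.
have [s' Ks' H] := travel_supp_simplex t (bary_supp x).
apply: simplex_face Ks' _ _.
  by move=> c /flow_coord_neq0[w xw]; exact: H.
apply: contrapT => N; have := flow_coord_sum x t.
rewrite fsbig1 => [/esym/eqP|c _]; first by rewrite oner_eq0.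
by apply/eqP; apply: contra_notT N => H0; exists c.
Qed.

Definition flow x t :=
  Realization (flow_coord_ge0 x t) (flow_coord_supp x t) (flow_coord_sum x t).

Definition vertex_coord (c : V) : R := (v 0%N == c)%:R.

Lemma vertex_coord_ge0 c : 0 <= vertex_coord c. Proof. exact: ler0n. Qed.

Lemma vertex_coord_supp : simplex K [set c | vertex_coord c != 0].
Proof.
suff -> : [set c | vertex_coord c != 0] = [set v 0%N] by [].
apply/seteqP; split=> c /=; rewrite /vertex_coord.
  by case: (v 0%N =P c) => [->|_] //; rewrite eqxx.
by move=> ->; rewrite eqxx oner_eq0.
Qed.

Lemma vertex_coord_sum : \sum_(c \in [set: V]) vertex_coord c = 1.
Proof.
rewrite (fsbigTE [fset v 0%N]%fset) => [|c].
  by rewrite big_seq_fset1 /vertex_coord eqxx.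
by rewrite inE eq_sym /vertex_coord => /negPf ->.
Qed.

Definition vertex0 :=
  Realization vertex_coord_ge0 vertex_coord_supp vertex_coord_sum.

Lemma flow_contraction : finitary_contraction flow vertex0.
Proof.
split.
- move=> s Ks; have /finite_fsetP[A sA] := simplex_finite Ks; subst s; split.
    exists (targets A) => x t c xA /flow_coord_neq0[w xw].
    by apply: travel_targets; exact: xA.
  move=> x t c xA /=.
  have FF := simplex_nbhs_filter [set` A] x.
  rewrite (flow_coordE _ _ xA).
  apply: cvg_trans (_ : (fun p => \sum_(w <- A) bary p.1 w * travel w p.2 c) @
    filter_prod (simplex_nbhs [set` A] x) (nbhs t) --> _).
    apply: near_eq_cvg.
    have clo : \forall p \near filter_prod (simplex_nbhs [set` A] x) (nbhs t),
        closed_simplex [set` A] p.1.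
      by apply: cvg_fst; exact: simplex_nbhs_closed.
    by near=> p; apply/esym/flow_coordE; near: p.
  apply: cvg_big => [|w _]; first exact: add_continuous.
  apply: cvgM.
    by apply: (cvg_comp fst (fun y => bary y w)) cvg_fst _; exact: cvg_bary.
  apply: (cvg_comp snd (fun t => travel w t c)) cvg_snd _.
  exact: travel_continuous.
- move=> x; apply: realization_eqP => c /=.
  have [A xA] := supp_fset x; rewrite (flow_coordE _ _ xA).
  under eq_bigr do rewrite travel0.
  have [cA|cA] := boolP (c \in A); first by rewrite sum_delta ?fset_uniq.
  have -> : bary x c = 0 by apply: contraNeq cA => /xA.
  rewrite big1_seq // => w /andP[_ wA].
  case: eqP => [wc|]; last by rewrite mulr0.
  by move: cA; rewrite -wc wA.
- move=> x; apply: realization_eqP => c /=.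
  have [A xA] := supp_fset x; rewrite (flow_coordE _ _ xA).
  under eq_bigr do rewrite travel1.
  by rewrite -mulr_suml sum_bary ?mul1r.
Unshelve. all: by end_near. Qed.

End ConeSequence.

(** * From a nerve to chains of intersections *)

(** Let [u g] be the greatest coordinate of [y] at a vertex that misses the
    point [g].  The sublevel sets of [u] are the intersections of the vertices
    of [y] whose coordinates exceed a threshold; they are nested.  Up to
    normalization, the image of [y] gives to a set [C] the length of the
    interval of thresholds for which [C] is the sublevel set, so it is a
    combination of nested intersections.  These lengths are differences of an
    infimum and a supremum of [u], hence Lipschitz functions of [y]. *)

Section IntersectionMap.
Variables (R : realType) (T : choiceType) (P : set (set T)).
Variable N : simplicial_complex (set T).
Local Open Scope ring_scope.

Hypothesis simplex_bigcap : forall s, simplex N s -> P (\bigcap_(C in s) C).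

Implicit Types (y z : realization R N) (C : set T).

Definition missing y g : R :=
  sup [set a | a = 0 \/ exists2 w, ~ w g & a = bary y w].

(** The values 0 here and 1 below are bounds for [missing]; adding them makes
    the sets nonempty whatever [C] is. *)
Definition missing_in y C : R :=
  sup [set a | a = 0 \/ exists2 g, C g & a = missing y g].

Definition missing_out y C : R :=
  inf [set a | a = 1 \/ exists2 g, ~ C g & a = missing y g].

Lemma missing_ub y g :
  ubound [set a | a = 0 \/ exists2 w, ~ w g & a = bary y w] 1.
Proof. by move=> a [->|[w _ ->]]; [exact: ler01|exact: bary_le1]. Qed.

Lemma missing_ge y g w : ~ w g -> bary y w <= missing y g.
Proof.
move=> wg; apply: ub_le_sup; first by exists 1; exact: missing_ub.
by right; exists w.
Qed.

Lemma missing_le y g b : 0 <= b -> (forall w, ~ w g -> bary y w <= b) ->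
  missing y g <= b.
Proof.
move=> b0 H; apply: ge_sup; first by exists 0; left.
by move=> a [->|[w wg ->]] //; exact: H.
Qed.

Lemma missing_ge0 y g : 0 <= missing y g.
Proof. by apply: ub_le_sup; [exists 1; exact: missing_ub|left]. Qed.

Lemma missing_le1 y g : missing y g <= 1.
Proof. by apply: missing_le => // w _; exact: bary_le1. Qed.

Lemma missing_in_ge y C g : C g -> missing y g <= missing_in y C.
Proof.
move=> Cg; apply: ub_le_sup; last by right; exists g.
by exists 1 => a [->|[h _ ->]] //; exact: missing_le1.
Qed.

Lemma missing_in_le y C b : 0 <= b -> (forall g, C g -> missing y g <= b) ->
  missing_in y C <= b.
Proof.
move=> b0 H; apply: ge_sup; first by exists 0; left.
by move=> a [->|[w wg ->]] //; exact: H.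
Qed.

Lemma missing_in_ge0 y C : 0 <= missing_in y C.
Proof.
apply: ub_le_sup; last by left.
by exists 1 => a [->|[h _ ->]] //; exact: missing_le1.
Qed.

Lemma missing_out_le y C g : ~ C g -> missing_out y C <= missing y g.
Proof.
move=> Cg; apply: ge_inf; last by right; exists g.
by exists 0 => a [->|[h _ ->]] //; exact: missing_ge0.
Qed.

Lemma missing_out_ge y C b : b <= 1 -> (forall g, ~ C g -> b <= missing y g) ->
  b <= missing_out y C.
Proof.
move=> b1 H; apply: lb_le_inf; first by exists 1; left.
by move=> a [->|[w wg ->]] //; exact: H.
Qed.

Lemma missing_out_le1 y C : missing_out y C <= 1.
Proof.
apply: ge_inf; last by left.
by exists 0 => a [->|[h _ ->]] //; exact: missing_ge0.
Qed.

Section Lipschitz.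
Variables (y z : realization R N) (e : R).
Hypothesis yz : forall w, bary y w <= bary z w + e.

(** Both families of coordinates have sum 1, so one cannot be everywhere smaller
    than the other. *)
Lemma lipschitz_ge0 : 0 <= e.
Proof.
have [A zA] := supp_fset z.
have [A' yA'] := supp_fset y.
rewrite leNgt; apply/negP => e0.
have : \sum_(w <- (A `|` A')%fset) bary y w <
       \sum_(w <- (A `|` A')%fset) bary z w.
  have [w zw] := bary_neq0_ex z.
  have wA : w \in (A `|` A')%fset by rewrite inE; apply/orP; left; exact: zA.
  rewrite (bigD1_seq w) ?fset_uniq //= [ltRHS](bigD1_seq w) ?fset_uniq //=.
  apply: ltr_leD; first by have := yz w; lra.
  by apply: ler_sum => u _; have := yz u; lra.
rewrite !sum_bary ?ltxx // => w.
- by move/zA; rewrite /= inE => ->.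
- by move/yA'; rewrite /= inE => ->; rewrite orbT.
Qed.

Lemma missing_lipschitz g : missing y g <= missing z g + e.
Proof.
apply: missing_le => [|w wg].
  by rewrite addr_ge0 ?missing_ge0 ?lipschitz_ge0.
by apply: le_trans (yz w) _; rewrite lerD2r missing_ge.
Qed.

Lemma missing_in_lipschitz C : missing_in y C <= missing_in z C + e.
Proof.
apply: missing_in_le => [|g Cg].
  by rewrite addr_ge0 ?missing_in_ge0 ?lipschitz_ge0.
by apply: le_trans (missing_lipschitz g) _; rewrite lerD2r missing_in_ge.
Qed.

Lemma missing_out_lipschitz C : missing_out y C <= missing_out z C + e.
Proof.
rewrite -lerBlDr; apply: missing_out_ge => [|g Cg].
  by have := missing_out_le1 y C; have := lipschitz_ge0; lra.
have := missing_lipschitz g; have := missing_out_le y Cg; lra.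
Qed.

End Lipschitz.

(** The first factor excludes the whole space, which would otherwise count the
    thresholds above the greatest coordinate. *)
Definition weight y C : R :=
  (`[< P C >])%:R * Num.max 0 (missing_out y C - missing_in y C).

Lemma weight_ge0 y C : 0 <= weight y C.
Proof. by rewrite mulr_ge0 ?ler0n // le_max lexx. Qed.

Lemma weight_neq0 y C : weight y C != 0 ->
  P C /\ missing_in y C < missing_out y C.
Proof.
rewrite /weight mulf_eq0 negb_or => /andP[].
case: asboolP => [PC _|_]; last by rewrite eqxx.
move=> H; split=> //; rewrite ltNge; apply: contra H => H.
by apply/eqP/max_idPl; rewrite subr_le0.
Qed.

Lemma weight_lipschitz y z e C :
  (forall w, `|bary y w - bary z w| <= e) ->
  `|weight y C - weight z C| <= e + e.
Proof.
move=> H.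
have yz w : bary y w <= bary z w + e.
  by have := H w; rewrite ler_norml => /andP[]; lra.
have zy w : bary z w <= bary y w + e.
  by have := H w; rewrite ler_norml => /andP[]; lra.
have e0 := lipschitz_ge0 yz.
rewrite /weight; case: asboolP => _; last first.
  by rewrite !mul0r subrr normr0 addr_ge0.
rewrite !mul1r.
have := missing_in_lipschitz yz C; have := missing_in_lipschitz zy C.
have := missing_out_lipschitz yz C; have := missing_out_lipschitz zy C.
rewrite ler_norml.
case: (leP 0 (missing_out y C - missing_in y C)) => h1;
case: (leP 0 (missing_out z C - missing_in z C)) => h2; move=> *;
apply/andP; split; lra.
Qed.

(** The threshold used here is the least one that yields [C]. *)
Lemma level_setE y C : P C -> missing_in y C < missing_out y C ->
  C = \bigcap_(w in [set w | missing_in y C < bary y w]) w.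
Proof.
move=> PC lt; apply/seteqP; split=> g /= H.
  move=> w /= yw; apply: contrapT => wg; move: yw; apply/negP; rewrite -leNgt.
  exact: le_trans (missing_ge y wg) (missing_in_ge y H).
apply: contrapT => Cg; have := lt_le_trans lt (missing_out_le y Cg).
apply/negP; rewrite -leNgt; apply: missing_le => [|w wg].
  exact: missing_in_ge0.
by rewrite leNgt; apply/negP => /H.
Qed.

(** A finite set that contains the supports of all images of points of [A]. *)
Definition caps (A : {fset set T}) : {fset set T} :=
  [fset \bigcap_(w in [set` (B : {fset set T})]) w | B in fpowerset A]%fset.

Lemma weight_caps (A : {fset set T}) y C : closed_simplex [set` A] y ->
  weight y C != 0 -> C \in caps A.
Proof.
move=> yA /weight_neq0[PC lt]; apply/imfsetP => /=.
exists [fset w in A | missing_in y C < bary y w]%fset.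
  by rewrite fpowersetE; apply/fsubsetP => w; rewrite !inE => /andP[].
rewrite {1}(level_setE PC lt); congr (\bigcap_(w in _) w).
apply/seteqP; split=> w /=; rewrite !inE /=; last by case/andP.
move=> lw; rewrite lw andbT; apply: yA => /=.
by rewrite gt_eqF //; apply: le_lt_trans lw; exact: missing_in_ge0.
Qed.

Lemma seq_argmax (l : seq (set T)) (f : set T -> R) w : w \in l ->
  exists2 u, u \in l & forall v, v \in l -> f v <= f u.
Proof.
elim: l w => // a [|b l] IH w _.
  by exists a; rewrite ?mem_head // => v; rewrite inE => /eqP->.
have [u ul H] := IH b (mem_head _ _).
have [au|ua] := leP (f a) (f u).
  exists u; first by rewrite inE ul orbT.
  by move=> v; rewrite inE => /orP[/eqP->//|/H].
exists a; first exact: mem_head.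
by move=> v; rewrite inE => /orP[/eqP->//|/H/le_trans]; apply; exact: ltW.
Qed.

(** The intersection of the vertices at which the coordinate of [y] is maximal
    has positive weight: it is the sublevel set for all thresholds from the next
    smaller coordinate up to the maximum. *)
Lemma weight_ex y : exists C, weight y C != 0.
Proof.
have [A yA] := supp_fset y; have [w0 yw0] := bary_neq0_ex y.
have [u uA umax] := seq_argmax (bary y) (yA _ yw0).
(* The maximum over [A] is a maximum over all vertices. *)
have {}umax w : bary y w <= bary y u.
  have [->|/yA] := eqVneq (bary y w) 0; last exact: umax.
  exact: bary_ge0.
have u0 : 0 < bary y u.
  by apply: lt_le_trans (umax w0); rewrite lt0r yw0 bary_ge0.
(* [m] bounds the coordinates other than the maximum. *)
have [m [m0 mu Hm]] : exists m, [/\ 0 <= m, m < bary y u &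
    forall w, bary y w != bary y u -> bary y w <= m].
  suff [m [m0 mu Hm]] : exists m, [/\ 0 <= m, m < bary y u &
      forall w, w \in enum_fset A -> bary y w != bary y u -> bary y w <= m].
    exists m; split=> // w wu.
    have [->//|/yA] := eqVneq (bary y w) 0; last by move=> wA; exact: Hm.
  elim: (enum_fset A) => [|a l [m [m0 mu Hm]]]; first by exists 0.
  have [au|au] := eqVneq (bary y a) (bary y u).
    exists m; split=> // w; rewrite inE => /orP[/eqP->|]; last exact: Hm.
    by rewrite au eqxx.
  exists (Num.max m (bary y a)); split.
  - by rewrite le_max m0.
  - by rewrite gt_max mu lt_neqAle au umax.
  - move=> w; rewrite inE le_max => /orP[/eqP->|/Hm H /H -> //].
    by rewrite lexx orbT.
pose S := [set w | bary y w = bary y u].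
have NS : simplex N S.
  apply: simplex_face (bary_supp y) _ _; last by exists u.
  by move=> w /= ->; rewrite gt_eqF.
exists (\bigcap_(C in S) C).
set C := \bigcap_(C in S) C.
have PC : P C by exact: simplex_bigcap.
rewrite /weight asboolT // mul1r gt_eqF // lt_max ltxx /= subr_gt0.
apply: (@le_lt_trans _ _ m); last apply: lt_le_trans mu _.
  apply: missing_in_le => // g Cg; apply: missing_le => // w wg; apply: Hm.
  by apply: contra_not_neq wg => wu; exact: (Cg w wu).
apply: missing_out_ge => [|g Cg]; first exact: bary_le1.
have [w Sw wg] : exists2 w, S w & ~ w g.
  by apply: contra_notP Cg => H w Sw; apply: contrapT => wg; apply: H; exists w.
by rewrite -Sw; exact: missing_ge.
Qed.

Definition total_weight y : R := \sum_(C \in [set: set T]) weight y C.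

Lemma total_weightE (A : {fset set T}) y : closed_simplex [set` A] y ->
  total_weight y = \sum_(C <- caps A) weight y C.
Proof.
move=> yA; apply: fsbigTE => C; apply: contraNeq; exact: weight_caps.
Qed.

Lemma total_weight_gt0 y : 0 < total_weight y.
Proof.
have [C wC] := weight_ex y; have [A yA] := supp_fset y.
rewrite (total_weightE yA) (bigD1_seq C) ?fset_uniq ?(weight_caps yA wC) //=.
apply: ltr_wpDr; last by rewrite lt0r wC weight_ge0.
by apply: sumr_ge0 => *; exact: weight_ge0.
Qed.

Definition cap_coord y C : R := weight y C / total_weight y.

Lemma cap_coord_neq0 y C : (cap_coord y C != 0) = (weight y C != 0).
Proof.
by rewrite mulf_eq0 invr_eq0 (gt_eqF (total_weight_gt0 y)) orbF.
Qed.

Lemma cap_coord_ge0 y C : 0 <= cap_coord y C.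
Proof. by rewrite divr_ge0 ?weight_ge0 ?ltW ?total_weight_gt0. Qed.

Lemma cap_coord_sum y : \sum_(C \in [set: set T]) cap_coord y C = 1.
Proof.
have [A yA] := supp_fset y.
rewrite (fsbigTE (caps A)) => [|C].
  rewrite -mulr_suml -total_weightE // divff // gt_eqF //.
  exact: total_weight_gt0.
by apply: contraNeq; rewrite cap_coord_neq0; exact: weight_caps.
Qed.

Lemma cap_coord_supp y :
  order_simplex subset P [set C | cap_coord y C != 0].
Proof.
have [A yA] := supp_fset y; split.
- apply: (@sub_finite_set _ _ [set` caps A]); last exact: finite_fset.
  by move=> C /=; rewrite cap_coord_neq0; exact: weight_caps.
- by have [C wC] := weight_ex y; exists C; rewrite /= cap_coord_neq0.
- by move=> C /=; rewrite cap_coord_neq0 => /weight_neq0[].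
- move=> C D /=; rewrite !cap_coord_neq0.
  move=> /weight_neq0[PC lC] /weight_neq0[PD lD].
  rewrite (level_setE PC lC) (level_setE PD lD).
  have [CD|DC] := leP (missing_in y C) (missing_in y D); [left|right].
    by move=> g H w /= Dw; apply: H => /=; exact: le_lt_trans Dw.
  by move=> g H w /= Cw; apply: H => /=; exact: lt_trans Cw.
Qed.

Lemma finitary_cap (V : choiceType) (K : simplicial_complex V)
    (F : realization R K -> R -> realization R N) :
  finitary (fun x t => bary (F x t)) ->
  finitary (fun x t => cap_coord (F x t)).
Proof.
move=> fF s Ks; have [[l Fl] _] := fF s Ks.
pose A := [fset w in l]%fset.
have FA x t : closed_simplex s x -> closed_simplex [set` A] (F x t).
  by move=> sx w /(Fl _ _ _ sx); rewrite /= inE.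
split.
  exists (caps A) => x t C sx; rewrite cap_coord_neq0.
  by apply: weight_caps; exact: FA.
move=> x t C sx.
have FF := simplex_nbhs_filter s x.
have cw D : (fun p => weight (F p.1 p.2) D) @
    filter_prod (simplex_nbhs s x) (nbhs t) --> weight (F x t) D.
  apply/cvgrPdist_le => e e0.
  have e2 : 0 < e / 2 by lra.
  have unif := finitary_uniform t fF Ks sx e2.
  near=> p; rewrite [e]splitr; apply: weight_lipschitz => w; apply: ltW.
  by move: w; near: p.
apply: cvgM; first exact: cw.
apply: cvgV; first by rewrite gt_eqF ?total_weight_gt0.
rewrite (total_weightE (FA _ _ sx)).
apply: cvg_trans (_ : (fun p => \sum_(D <- caps A) weight (F p.1 p.2) D) @
  filter_prod (simplex_nbhs s x) (nbhs t) --> _).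
  apply: near_eq_cvg.
  have clo : \forall p \near filter_prod (simplex_nbhs s x) (nbhs t),
      closed_simplex s p.1.
    by apply: cvg_fst; exact: simplex_nbhs_closed.
  by near=> p; apply/esym/total_weightE/FA; near: p.
by apply: cvg_big => [|D _]; [exact: add_continuous|exact: cw].
Unshelve. all: by end_near. Qed.

End IntersectionMap.

Section OrderComplexContraction.
Variables (R : realType) (T : choiceType) (P : set (set T)).
Variable N : simplicial_complex (set T).
Local Open Scope ring_scope.

Hypothesis simplex_bigcap : forall s, simplex N s -> P (\bigcap_(C in s) C).
Hypothesis P_proper : forall C, P C -> C <> [set: T].
Hypothesis chain_simplex : order_simplex subset P `<=` simplex N.

Let Delta := order_complex subset P.

Lemma chain_min (s : seq (set T)) C : C \in s -> total_on [set` s] subset ->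
  exists2 D, D \in s & forall E, E \in s -> D `<=` E.
Proof.
elim: s C => // a [|b s] IH C _ tot.
  by exists a; rewrite ?mem_head // => E; rewrite inE => /eqP->.
have [|D Ds HD] := IH b (mem_head _ _).
  by move=> x y xs ys; apply: tot; rewrite /= inE ?xs ?ys orbT.
have Da : D \in a :: b :: s by rewrite inE Ds orbT.
have [aD|Da'] := tot a D (mem_head _ _) Da.
  exists a; first exact: mem_head.
  by move=> E; rewrite inE => /orP[/eqP->//|/HD/(subset_trans aD)].
by exists D => // E; rewrite inE => /orP[/eqP->//|/HD].
Qed.

Definition chain_incl (x : realization R Delta) : realization R N :=
  Realization (bary_ge0 x) (chain_simplex (bary_supp x)) (bary_sum x).

(** An intersection of members of a finite chain is one of them. *)
Lemma chain_cap x C : cap_coord P (chain_incl x) C != 0 -> bary x C != 0.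
Proof.
rewrite cap_coord_neq0 // => /weight_neq0[PC lt].
have := level_setE PC lt; set a := missing_in _ _.
set S := [set w | a < bary _ w] => CE.
have a0 : 0 <= a by exact: missing_in_ge0.
have SS w : S w -> bary x w != 0.
  by move=> Sw; rewrite gt_eqF // (le_lt_trans a0).
have /finite_seqP[l lE] : finite_set S.
  by apply: sub_finite_set (finite_supp x); exact: SS.
have [w wl] : exists w, w \in l.
  apply: contrapT => nl; apply: (P_proper PC); rewrite CE lE.
  apply/seteqP; split=> // g _ w wl; exfalso; apply: nl; by exists w.
have [_ _ _ tot] : order_simplex subset P [set v | bary x v != 0].
  exact: (bary_supp x).
have [|D Dl HD] := chain_min wl.
  by rewrite -lE => u v /SS su /SS sv; exact: tot.
have -> : C = D.
  rewrite CE lE; apply/seteqP; split=> g; first by apply.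
  by move=> Dg E /HD; apply.
by apply: SS; rewrite lE.
Qed.

Variables (F : realization R N -> R -> realization R N) (x0 : realization R N).
Hypothesis F_contr : finitary_contraction F x0.

(** The point rests until time [1/2], and undergoes the contraction [F]
    afterwards. *)
Definition moved (x : realization R Delta) t :=
  F (chain_incl x) (clamp (2 * t - 1)).

(** Before time [1/2] this is a segment from [x] to its image in the order
    complex; afterwards the first term vanishes.  A single formula for both
    halves spares the gluing of two homotopies. *)
Definition slide_coord (x : realization R Delta) t C : R :=
  (1 - clamp (2 * t)) * bary x C + clamp (2 * t) * cap_coord P (moved x t) C.

Lemma slide_coord_ge0 x t C : 0 <= slide_coord x t C.
Proof.
rewrite addr_ge0 // mulr_ge0 ?clamp_ge0 ?bary_ge0 ?cap_coord_ge0 //.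
by rewrite subr_ge0 clamp_le1.
Qed.

Lemma slide_coord_neq0 x t C : slide_coord x t C != 0 ->
  bary x C != 0 \/ cap_coord P (moved x t) C != 0.
Proof.
rewrite /slide_coord; have [->|] := eqVneq (bary x C) 0; last by left.
have [->|] := eqVneq (cap_coord _ _ _) 0; last by right.
by rewrite !mulr0 addr0 eqxx.
Qed.

Lemma slide_coord_sum x t : \sum_(C \in [set: set T]) slide_coord x t C = 1.
Proof.
have [A xA] := supp_fset x.
have /finite_fsetP[B BE] : finite_set [set C | cap_coord P (moved x t) C != 0].
  by have [] := cap_coord_supp simplex_bigcap (moved x t).
have cB C : cap_coord P (moved x t) C != 0 -> C \in B.
  by move=> ?; have : [set` B] C by rewrite -BE.
rewrite (fsbigTE (A `|` B)%fset) => [|C]; last first.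
  apply: contraNeq => /slide_coord_neq0[/xA /=|/cB]; rewrite inE => ->//.
  by rewrite orbT.
rewrite big_split /= -!mulr_sumr sum_bary => [|C /xA]; last first.
  by rewrite /= inE => ->.
rewrite -(@fsbigTE _ _ _ _ _ (cap_coord P (moved x t))) ?cap_coord_sum //.
  by ring.
by move=> C; apply: contraNeq => /cB; rewrite inE orbC => ->.
Qed.

Lemma slide_coord_supp x t : simplex Delta [set C | slide_coord x t C != 0].
Proof.
have n0 : [set C | slide_coord x t C != 0] !=set0.
  apply: contrapT => n0; have := slide_coord_sum x t.
  rewrite fsbig1 => [/esym/eqP|C _]; first by rewrite oner_eq0.
  by apply/eqP; apply: contra_notT n0 => H; exists C.
have [t1|t1] := leP 1 (2 * t).
  apply: (@simplex_face _ Delta _ _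
    (cap_coord_supp simplex_bigcap (moved x t)) _ n0).
  by move=> C /=; rewrite /slide_coord clamp_ge1 // subrr mul0r add0r mul1r.
apply: simplex_face (bary_supp x) _ n0 => C /slide_coord_neq0[//|].
rewrite /moved clamp_le0; last by lra.
by have [_ -> _] := F_contr; exact: chain_cap.
Qed.

Definition slide x t :=
  Realization (slide_coord_ge0 x t) (slide_coord_supp x t)
    (slide_coord_sum x t).

Definition cap_point (y : realization R N) : realization R Delta :=
  @Realization _ _ Delta _ (cap_coord_ge0 simplex_bigcap y)
    (cap_coord_supp simplex_bigcap y) (cap_coord_sum simplex_bigcap y).

Lemma finitary_moved : finitary (fun x t => bary (moved x t)).
Proof.
have [fF _ _] := F_contr.
move=> s Ks; have Ns : simplex N s by exact: chain_simplex.
have [[l Fl] Fc] := fF s Ns; split.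
  by exists l => x t C sx; exact: (Fl (chain_incl x)).
move=> x t C sx.
have FF := simplex_nbhs_filter s x.
apply: (@cvg_comp _ _ _ (fun p => (chain_incl p.1, clamp (2 * p.2 - 1)))
  (fun q => bary (F q.1 q.2) C) _ _ _ _
  (Fc (chain_incl x) (clamp (2 * t - 1)) C sx)).
have FF' := simplex_nbhs_filter s (chain_incl x).
have c1 : (fun p : realization R Delta * R => chain_incl p.1) @
    filter_prod (simplex_nbhs s x) (nbhs t) `=>` simplex_nbhs s (chain_incl x).
  apply: (cvg_comp fst chain_incl cvg_fst) => A [e e0 H].
  by exists e => // y sy xy; exact: (H (chain_incl y)).
have c2 : (fun p : realization R Delta * R => clamp (2 * p.2 - 1)) @
    filter_prod (simplex_nbhs s x) (nbhs t) --> clamp (2 * t - 1).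
  apply: (cvg_comp snd (fun t => clamp (2 * t - 1)) cvg_snd).
  apply: cvg_clamp; apply: cvgB; last exact: cvg_cst.
  by apply: cvgM; [exact: cvg_cst|exact: cvg_id].
exact: (cvg_pair c1 c2).
Qed.

Lemma slide_contraction : finitary_contraction slide (cap_point x0).
Proof.
have [fF F0 F1] := F_contr; split.
- move=> s Ks; have := finitary_cap simplex_bigcap finitary_moved Ks.
  move=> [[l Hl] Hc]; have /finite_seqP[l' sE] := simplex_finite Ks; split.
    exists (l' ++ l) => x t C sx /slide_coord_neq0[xC|/(Hl _ _ _ sx)].
      by rewrite mem_cat; apply/orP; left; have := sx _ xC; rewrite sE.
    by rewrite mem_cat orbC => ->.
  move=> x t C sx.
  have FF := simplex_nbhs_filter s x.
  have c2 : (fun p => clamp (2 * p.2)) @ filter_prod (simplex_nbhs s x) (nbhs t)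
      --> clamp (2 * t).
    apply: (cvg_comp snd (fun t => clamp (2 * t)) cvg_snd).
    by apply: cvg_clamp; apply: cvgM; [exact: cvg_cst|exact: cvg_id].
  apply: cvgD; apply: cvgM => //; last exact: Hc.
    by apply: cvgB => //; exact: cvg_cst.
  by apply: (cvg_comp fst (fun y => bary y C)) cvg_fst _; exact: cvg_bary.
- move=> x; apply: realization_eqP => C /=.
  by rewrite /slide_coord mulr0 clamp_le0 // subr0 mul1r mul0r addr0.
- move=> x; apply: realization_eqP => C /=.
  rewrite /slide_coord /moved !clamp_ge1; try lra.
  by rewrite F1 subrr mul0r add0r mul1r.
Qed.

End OrderComplexContraction.

(** * Finite index subgroups and actions on finite sets *)

Section Actions.
Local Open Scope group_scope.

Definition is_action (G : groupType) (T : Type) (act : T -> G -> T) :=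
  (forall x, act x 1 = x) /\ forall x g h, act x (g * h) = act (act x g) h.

Definition finite_index (G : groupType) (H : set G) :=
  is_subgroup H /\ finite_set (right_cosets H).

Section Subgroups.
Variable G : groupType.
Implicit Types (H : set G) (g h : G).

Lemma subgroup_mul H x y : is_subgroup H -> H x -> H y -> H (x * y).
Proof.
move=> [H1 HVm] Hx Hy; rewrite -[y]invgK; apply: (HVm) => //.
by rewrite -[y^-1]mul1g; exact: (HVm).
Qed.

Lemma subgroup_inv H x : is_subgroup H -> H x -> H x^-1.
Proof. by move=> [H1 HVm] Hx; rewrite -[x^-1]mul1g; exact: (HVm). Qed.

Lemma right_cosetP H g x : is_subgroup H -> right_coset H g x <-> H (x * g^-1).
Proof.
move=> sH; split; first by move=> [h Hh <-]; rewrite mulgK.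
by move=> Hx; exists (x * g^-1) => //; rewrite mulgVK.
Qed.

Lemma right_coset_refl H g : is_subgroup H -> right_coset H g g.
Proof. by move=> sH; apply/right_cosetP; rewrite // mulgV; case: sH. Qed.

Lemma right_coset_eq H g h : is_subgroup H ->
  right_coset H g = right_coset H h <-> H (g * h^-1).
Proof.
move=> sH; split=> [gh|Hgh].
  by apply/right_cosetP => //; rewrite -gh; exact: right_coset_refl.
apply/seteqP; split=> x /right_cosetP-/(_ sH) Hx; apply/right_cosetP => //.
  by have := subgroup_mul sH Hx Hgh; rewrite mulgA mulgVK.
have := subgroup_mul sH Hx (subgroup_inv sH Hgh).
by rewrite invgM invgK mulgA mulgVK.
Qed.

(** The action by right multiplication on the cosets, transported to ['I_n]. *)
Lemma coset_action H n : is_subgroup H -> has_index H n ->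
  exists (act : 'I_n -> G -> 'I_n) (c : 'I_n),
    [/\ is_action act, forall i, exists g, act c g = i &
        forall g, act c g = c <-> H g].
Proof.
move=> sH /card_set_bijP[f [fn finj fsurj]].
have rcH g : right_cosets H (right_coset H g) by exists g.
(* The number of the coset of [g]. *)
pose ix g : 'I_n := Ordinal (fn _ (rcH g)).
have ixE g h : ix g = ix h <-> H (g * h^-1).
  rewrite -right_coset_eq //; split=> [/(congr1 val) /= E|E].
    by apply: finj => //; exact: mem_set.
  by apply/val_inj; rewrite /= E.
have /choice[rep repE] : forall i, exists g, ix g = i.
  move=> i; have [_ [g _ <-] fg] := fsurj i (ltn_ord i).
  by exists g; apply/val_inj.
pose act i g := ix (rep i * g).
have actE g h : act (ix g) h = ix (g * h).
  apply/ixE; have /ixE := repE (ix g).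
  by rewrite invgM mulgA mulgK.
exists act, (ix 1); split.
- split=> [i|i g h]; first by rewrite /act mulg1.
  by rewrite [act i g]/act actE -mulgA.
- by move=> i; exists (rep i); rewrite actE mul1g.
- by move=> g; rewrite actE mul1g ixE invg1 mulg1.
Qed.

(** The coset of [g] is determined by [act x g], which has finitely many
    values. *)
Lemma stabilizer_finite_index (T : finType) (act : T -> G -> T) x :
  is_action act -> finite_index [set g | act x g = x].
Proof.
move=> [a1 aM]; have actV g y : act x g = y -> x = act y g^-1.
  by move=> <-; rewrite -aM mulgV a1.
have sH : is_subgroup [set g | act x g = x].
  split=> [|g h /= xg xh]; first exact: a1.
  by rewrite aM xg -(actV _ _ xh).
split=> //; apply: (@sub_finite_set _ _
    ((fun t => [set g | act x g = t]) @` [set: T])); last first.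
  by apply: finite_image; exact: finite_finset.
move=> _ [g _ <-]; exists (act x g) => //; apply/seteqP; split=> h /=.
  move=> xh; apply/right_cosetP => //=.
  by rewrite aM xh -aM mulgV a1.
move=> /right_cosetP-/(_ sH) => /=; rewrite aM => /(congr1 (act^~ g)).
by rewrite -aM mulVg a1.
Qed.

Lemma finite_indexI H1 H2 :
  finite_index H1 -> finite_index H2 -> finite_index (H1 `&` H2).
Proof.
move=> [s1 f1] [s2 f2]; have s12 : is_subgroup (H1 `&` H2).
  case: s1 s2 => [h1 d1] [h2 d2]; split=> // x y [x1 x2] [y1 y2].
  by split; [exact: d1|exact: d2].
split=> //; apply: (@sub_finite_set _ _
    ((fun p => p.1 `&` p.2) @` (right_cosets H1 `*` right_cosets H2))).
  move=> _ [g _ <-]; exists (right_coset H1 g, right_coset H2 g).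
    by split; exists g.
  apply/seteqP; split=> x /=.
    move=> [/right_cosetP-/(_ s1) x1 /right_cosetP-/(_ s2) x2].
    exact/right_cosetP.
  move=> x12; have [x1 x2] := (right_cosetP _ _ s12).1 x12.
  by split; apply/right_cosetP.
by apply: finite_image; exact: finite_setX.
Qed.

Lemma finite_indexT : finite_index [set: G].
Proof.
have sT : is_subgroup [set: G] by [].
split=> //; apply: (@sub_finite_set _ _ [set [set: G]]); last first.
  exact: finite_set1.
by move=> _ [g _ <-]; apply/seteqP; split=> // x _; apply/right_cosetP.
Qed.

Lemma HfiP H : Hfi G H <-> finite_index H /\ H <> [set: G].
Proof.
split; first by move=> [[sH HT] fH]; split=> //; split=> //; apply/finite_setP.
by move=> [[sH /finite_setP fH] HT].
Qed.

End Subgroups.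

(** By transitivity, each point of [T1] is related to the same number of points
    of [T2]. *)
Lemma invariant_rel_dvd (G : groupType) (T1 T2 : finType)
    (act1 : T1 -> G -> T1) (act2 : T2 -> G -> T2) (r : T1 -> T2 -> bool) x0 :
  is_action act2 -> (forall x, exists g, act1 x0 g = x) ->
  (forall x y g, r (act1 x g) (act2 y g) = r x y) ->
  (#|T1| %| \sum_(x : T1) \sum_(y : T2) r x y)%N.
Proof.
move=> [a1 aM] trans rinv.
rewrite (eq_bigr (fun=> \sum_(y : T2) r x0 y)%N) => [|x _].
  by rewrite sum_nat_const dvdn_mulr.
have [g <-] := trans x; rewrite (reindex (act2^~ g)) /=.
  by apply: eq_bigr => y _; rewrite rinv.
by exists (act2^~ g^-1) => y _ /=; rewrite -aM ?mulgV ?mulVg a1.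
Qed.

(** The cardinality of an orbit in [T1 * T2] is a multiple of [#|T1|] and of
    [#|T2|], hence of their product: the orbit is the whole product. *)
Lemma coprime_transitive (G : groupType) (T1 T2 : finType)
    (act1 : T1 -> G -> T1) (act2 : T2 -> G -> T2) x0 y0 :
  is_action act1 -> is_action act2 ->
  (forall x, exists g, act1 x0 g = x) -> (forall y, exists g, act2 y0 g = y) ->
  coprime #|T1| #|T2| ->
  forall x y, exists g, act1 x0 g = x /\ act2 y0 g = y.
Proof.
move=> A1 A2 t1 t2 co x y.
(* The orbit of [(x0, y0)]. *)
pose r x y := `[< exists g, act1 x0 g = x /\ act2 y0 g = y >].
have rinv u v g : r (act1 u g) (act2 v g) = r u v.
  case: A1 A2 => [a1 a1M] [a2 a2M].
  apply/asboolP/asboolP => -[h [hu hv]].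
    by exists (h * g^-1); rewrite a1M a2M hu hv -a1M -a2M mulgV.
  by exists (h * g); rewrite a1M a2M hu hv.
have d1 := invariant_rel_dvd A2 t1 rinv.
have d2 := invariant_rel_dvd (r := fun y x => r x y) A1 t2
  (fun u v g => rinv v u g).
rewrite exchange_big in d2.
have d12 : (#|{: T1 * T2}| %| \sum_(x : T1) \sum_(y : T2) r x y)%N.
  by rewrite card_prod Gauss_dvd // d1.
rewrite pair_big /= in d12.
have sE : (\sum_(p : T1 * T2) r p.1 p.2 =
    #|[set p : T1 * T2 | r p.1 p.2]%SET|)%N.
  rewrite -sum1_card [RHS]big_mkcond /=.
  by apply: eq_bigr => p _; rewrite inE; case: (r _ _).
rewrite sE in d12.
have le : (#|{: T1 * T2}| <= #|[set p : T1 * T2 | r p.1 p.2]%SET|)%N.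
  apply: dvdn_leq d12; apply/card_gt0P; exists (x0, y0); rewrite inE.
  by apply/asboolP; exists 1; case: A1 A2 => [-> _] [-> _].
have /setP/(_ (x, y)) :
    [set p : T1 * T2 | r p.1 p.2]%SET = [set: T1 * T2]%SET.
  by apply/eqP; rewrite eqEcard finset.subsetT cardsT.
by rewrite !inE /= => /asboolP.
Qed.

(** A disjoint family of copies of [A] in [T], indexed by [J], lets an action on
    [A] operate on [T], with the other points of [T] fixed. *)

Section ExtendedAction.
Variables (G : groupType) (J A T : finType).
Variables (e : J * A -> T) (act : A -> G -> A).
Hypothesis e_inj : injective e.

Definition extended_action x g : T :=
  if [pick p | e p == x] is Some p then e (p.1, act p.2 g) else x.

Lemma extended_actionE j a g : extended_action (e (j, a)) g = e (j, act a g).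
Proof.
rewrite /extended_action; case: pickP => [p /eqP/e_inj -> //|/(_ (j, a))].
by rewrite eqxx.
Qed.

Lemma extended_action_is_action : is_action act -> is_action extended_action.
Proof.
move=> [a1 aM].
have H x : (exists p, x = e p) \/ forall g, extended_action x g = x.
  rewrite /extended_action; case: pickP => [p /eqP <-|].
    by left; exists p.
  by right.
split=> [x|x g h]; have [[[j a] ->]|E] := H x; rewrite ?extended_actionE ?E //.
  by rewrite a1.
by rewrite aM.
Qed.

End ExtendedAction.

End Actions.

(** * Finite index subgroups of a free product *)

Section FreeProduct.
Variables G1 G2 : groupType.
Local Open Scope group_scope.
Local Open Scope quotient_scope.

Definition letter_inv (t : G1 + G2) : G1 + G2 :=
  match t with inl a => inl (a^-1) | inr b => inr (b^-1) end.

Definition fp_word (u : seq (G1 + G2)) : free_product G1 G2 :=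
  word_class letter_inv (@free_product_rel G1 G2) u.

Lemma fp_word_congr u v :
  word_congr letter_inv (@free_product_rel G1 G2) u v -> fp_word u = fp_word v.
Proof. by move=> uv; apply/word_classP. Qed.

Lemma fp_wordM u v : fp_word (u ++ v) = fp_word u * fp_word v.
Proof. by apply/esym; exact: word_mulE. Qed.

Lemma fp_word_surj (g : free_product G1 G2) : exists u, g = fp_word u.
Proof. by exists (repr g); apply/esym; exact: word_class_repr. Qed.

Section FreeProductAction.
Variables (T : Type) (act1 : T -> G1 -> T) (act2 : T -> G2 -> T).
Hypotheses (A1 : is_action act1) (A2 : is_action act2).

Definition letter_act x (t : G1 + G2) :=
  match t with inl a => act1 x a | inr b => act2 x b end.

(** Actions of both factors on the same set form an action of the free product,
    because they respect its defining relations. *)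
Lemma foldl_letter_act_congr u v :
  word_congr letter_inv (@free_product_rel G1 G2) u v ->
  forall x, foldl letter_act x u = foldl letter_act x v.
Proof.
case: A1 A2 => [a1 a1M] [a2 a2M].
elim=> {u v}.
- by move=> u v [a b|a b] x /=; rewrite ?a1M ?a2M.
- by move=> [a|b] x /=; rewrite -?a1M -?a2M mulgV.
- by move=> [a|b] x /=; rewrite -?a1M -?a2M mulVg.
- by [].
- by move=> u v _ IH x.
- by move=> v u w _ IH1 _ IH2 x; rewrite IH1.
- by move=> u u' v v' _ IH1 _ IH2 x; rewrite !foldl_cat IH1 IH2.
Qed.

Definition fp_act x (g : free_product G1 G2) : T := foldl letter_act x (repr g).

Lemma fp_actE x u : fp_act x (fp_word u) = foldl letter_act x u.
Proof.
apply: foldl_letter_act_congr; apply/word_classP; exact: word_class_repr.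
Qed.

Lemma fp_act_is_action : is_action fp_act.
Proof.
split=> [x|x g h]; first exact: (fp_actE x [::]).
have [u ->] := fp_word_surj g; have [v ->] := fp_word_surj h.
by rewrite -fp_wordM !fp_actE foldl_cat.
Qed.

End FreeProductAction.

Lemma proper_index_gt1 (G : groupType) (H : set G) n
    (act : 'I_n -> G -> 'I_n) (c : 'I_n) :
  (forall g, act c g = c <-> H g) -> H <> [set: G] -> (1 < n)%N.
Proof.
case: n act c => [|[|n]] act c st HT //; first by have := ltn_ord c.
exfalso; apply: HT; apply/seteqP; split=> // g _; apply/st.
by rewrite [LHS]ord1 [RHS]ord1.
Qed.

Lemma block_proof m s b n : (b + n <= s.+1)%N -> forall p : 'I_m * 'I_n,
  (p.1 * s + b + p.2 < (m * s).+1)%N.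
Proof.
move=> bn [[q qm] [r rn]] /=.
have : (q.+1 * s <= m * s)%N by rewrite leq_mul2r qm orbT.
by rewrite mulSn; lia.
Qed.

(** The [q]-th interval of length [n] among those that start at [b] and repeat
    with period [s]; it is contained in a segment of [s + 1] points, so
    that consecutive segments share an endpoint. *)
Definition block m s b n (bn : (b + n <= s.+1)%N) (p : 'I_m * 'I_n) :
  'I_(m * s).+1 := Ordinal (block_proof bn p).

Lemma block_inj m s b n (bn : (b + n <= s.+1)%N) : (n <= s)%N ->
  injective (@block m s b n bn).
Proof.
move=> ns [[q qm] [r rn]] [[q' qm'] [r' rn']] /(congr1 val) /= E.
have {}E : (q * s + r = q' * s + r')%N by lia.
have Er : r = r'.
  have : ((q * s + r) %% s = (q' * s + r') %% s)%N by rewrite E.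
  by rewrite !modnMDl !modn_small //; lia.
subst r'; have Eq : q = q'.
  have /eqP : (q * s = q' * s)%N by lia.
  by rewrite eqn_mul2r => /orP[/eqP|/eqP //]; lia.
by subst q'; congr (_, _); apply/val_inj.
Qed.

(** With period [s = n1 + n2 - 2], the interval for [H1] runs from [q s] to
    [q s + n1 - 1] and the interval for [H2] from there to [(q + 1) s].  Each
    point but the first is in an interval that starts at a smaller point, so
    all points are reached from [0]. *)
Lemma fp_transitive_action H1 H2 n1 n2 m :
  is_subgroup H1 -> H1 <> [set: G1] -> has_index H1 n1 ->
  is_subgroup H2 -> H2 <> [set: G2] -> has_index H2 n2 ->
  exists act : 'I_(m * (n1 + n2 - 2)).+1 -> free_product G1 G2 ->
               'I_(m * (n1 + n2 - 2)).+1,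
    [/\ is_action act, forall x, exists g, act ord0 g = x &
        (1 < n1 + n2 - 2)%N].
Proof.
move=> s1 p1 i1 s2 p2 i2.
have [act1 [c1 [A1 t1 st1]]] := coset_action s1 i1.
have [act2 [c2 [A2 t2 st2]]] := coset_action s2 i2.
have n1gt := proper_index_gt1 st1 p1; have n2gt := proper_index_gt1 st2 p2.
set s := (n1 + n2 - 2)%N.
have b1 : (0 + n1 <= s.+1)%N by rewrite /s; lia.
have b2 : (n1.-1 + n2 <= s.+1)%N by rewrite /s; lia.
have e1inj : injective (@block m s 0 n1 b1).
  by apply: block_inj; rewrite /s; lia.
have e2inj : injective (@block m s n1.-1 n2 b2).
  by apply: block_inj; rewrite /s; lia.
pose x1 := extended_action (@block m s 0 n1 b1) act1.
pose x2 := extended_action (@block m s n1.-1 n2 b2) act2.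
have X1 : is_action x1 by exact: extended_action_is_action.
have X2 : is_action x2 by exact: extended_action_is_action.
have X := fp_act_is_action X1 X2.
have tr (G : groupType) n (act : 'I_n -> G -> 'I_n) c : is_action act ->
    (forall i, exists g, act c g = i) -> forall i j, exists g, act i g = j.
  move=> [a1 aM] t i j; have [g gi] := t i; have [h hj] := t j.
  by exists (g^-1 * h); rewrite aM -gi -(aM c) mulgV a1.
exists (fp_act x1 x2); split => //; last by rewrite /s; lia.
move=> [x]; elim/ltn_ind: x => -[|x] IH xlt.
  by exists 1; rewrite (proj1 X); apply/val_inj.
have s0 : (0 < s)%N by rewrite /s; lia.
have qm : (x %/ s < m)%N by rewrite ltn_divLR.
have rs : (x %% s < s)%N by rewrite ltn_mod.
have xE := divn_eq x s.
have [rn|nr] := ltnP (x %% s).+1 n1.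
  have n10 : (0 < n1)%N by lia.
  pose y := @block m s 0 n1 b1 (Ordinal qm, Ordinal n10).
  have yx : (y < x.+1)%N by rewrite /=; lia.
  have [g gy] := IH y yx (ltn_ord y).
  have [h hx] := tr _ _ _ _ A1 t1 (Ordinal n10) (Ordinal rn).
  exists (g * fp_word [:: inl h]).
  rewrite (proj2 X) gy (_ : Ordinal _ = y); last exact/val_inj.
  rewrite fp_actE //= /x1 extended_actionE // hx; apply/val_inj => /=; lia.
have n20 : (0 < n2)%N by lia.
have rn : ((x %% s).+1 - n1.-1 < n2)%N by move: rs; rewrite /s; lia.
pose y := @block m s n1.-1 n2 b2 (Ordinal qm, Ordinal n20).
have yx : (y < x.+1)%N by rewrite /=; lia.
have [g gy] := IH y yx (ltn_ord y).
have [h hx] := tr _ _ _ _ A2 t2 (Ordinal n20) (Ordinal rn).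
exists (g * fp_word [:: inr h]).
rewrite (proj2 X) gy (_ : Ordinal _ = y); last exact/val_inj.
rewrite fp_actE //= /x2 extended_actionE // hx; apply/val_inj => /=; lia.
Qed.

(** [K] is the stabilizer of a point in an action on [m s + 1] points, where [m]
    is the index of [M]; this number is prime to [m]. *)
Lemma fp_coprime_complement (H1 : set G1) (H2 : set G2)
    (M : set (free_product G1 G2)) :
  Hfi G1 H1 -> Hfi G2 H2 -> finite_index M ->
  exists2 K, Hfi (free_product G1 G2) K &
    forall g, exists2 x, K x & right_coset M g x.
Proof.
move=> [[s1 p1] [n1 i1]] [[s2 p2] [n2 i2]] [sM /finite_setP[m iM]].
have [act [A t sgt]] := fp_transitive_action m s1 p1 i1 s2 p2 i2.
have [actM [c [AM tM stM]]] := coset_action sM iM.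
have m0 : (0 < m)%N by apply: leq_trans (ltn_ord c).
set s := (n1 + n2 - 2)%N in act A t sgt *.
exists [set g | act ord0 g = ord0].
  apply/HfiP; split; first exact: stabilizer_finite_index.
  move=> K; have lt1 : (1 < (m * s).+1)%N.
    by rewrite ltnS muln_gt0 m0; lia.
  have [g] := t (Ordinal lt1).
  have -> : act ord0 g = ord0.
    by have : [set: free_product G1 G2] g by []; rewrite -K.
  by move/(congr1 val).
move=> g.
have co : coprime #|'I_(m * s).+1| #|'I_m|.
  by rewrite !card_ord coprime_sym -addn1 /coprime mulnC gcdnMDl gcdn1.
have [h [h0 hg]] := coprime_transitive A AM t tM co ord0 (actM c g).
exists h => //; apply/right_cosetP => //; apply/stM.
by case: AM => a1 aM; rewrite aM hg -aM mulgV a1.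
Qed.

End FreeProduct.

(** * Finitely generated groups *)

Section Generation.
Local Open Scope group_scope.

Definition gen_prod (G : groupType) (S : Type) (e : S -> G) (u : seq S) : G :=
  foldr (fun s x => e s * x) 1 u.

Definition fin_generated (G : groupType) :=
  exists (S : finType) (e : S -> G), forall g, exists u, g = gen_prod e u.

Lemma gen_prod_cat (G : groupType) (S : Type) (e : S -> G) u v :
  gen_prod e (u ++ v) = gen_prod e u * gen_prod e v.
Proof. by elim: u => [|s u IH] /=; rewrite ?mul1g // IH mulgA. Qed.

Lemma gen_prod_morph (G H : groupType) (f : {multiplicative G -> H})
    (S : Type) (e : S -> G) u : f (gen_prod e u) = gen_prod (f \o e) u.
Proof.
elim: u => [|s u IH] /=; last by rewrite gmulfM IH.
by apply: (@mulgI _ (f 1)); rewrite -gmulfM !mulg1.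
Qed.

Lemma presented_fin_generated (G : groupType) (X : finType)
    (R : set (signed_word X)) :
  group_iso G (presented_group R) -> fin_generated G.
Proof.
move=> [f [f' fK f'K]].
pose c (u : signed_word X) : presented_group R :=
  word_class (fun l => (l.1, ~~ l.2)) (fun u v => R u /\ v = [::]) u.
have cE u : c u = gen_prod (fun l => c [:: l]) u.
  by elim: u => // l u IH; rewrite /= -IH; apply/esym; exact: word_mulE.
exists (X * bool)%type, (fun l => f' (c [:: l])) => g.
have [u gu] : exists u, f g = c u.
  by exists (repr (f g)); apply/esym; exact: word_class_repr.
exists u; apply: (can_inj fK); rewrite gen_prod_morph gu cE.
by elim: (u) => //= l v ->; rewrite f'K.
Qed.

Lemma fp_fin_generated (G1 G2 : groupType) :
  fin_generated G1 -> fin_generated G2 -> fin_generated (free_product G1 G2).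
Proof.
move=> [S1 [e1 gen1]] [S2 [e2 gen2]].
pose e (s : S1 + S2) : free_product G1 G2 :=
  match s with
  | inl a => fp_word [:: inl (e1 a)]
  | inr b => fp_word [:: inr (e2 b)]
  end.
have wl (a b : G1) : fp_word [:: inl (a * b)] =
    fp_word [:: inl a] * fp_word [:: inl b] :> free_product G1 G2.
  by rewrite -fp_wordM; apply/esym/fp_word_congr/word_congr_rel; constructor.
have wr (a b : G2) : fp_word [:: inr (a * b)] =
    fp_word [:: inr a] * fp_word [:: inr b] :> free_product G1 G2.
  by rewrite -fp_wordM; apply/esym/fp_word_congr/word_congr_rel; constructor.
have wl1 : fp_word [:: inl 1] = 1 :> free_product G1 G2.
  by apply: (mulgI (fp_word [:: inl 1])); rewrite mulg1 -wl mulg1.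
have wr1 : fp_word [:: inr 1] = 1 :> free_product G1 G2.
  by apply: (mulgI (fp_word [:: inr 1])); rewrite mulg1 -wr mulg1.
exists (S1 + S2)%type, e => g; have [u ->] := fp_word_surj g.
elim: u => [|t u [v IH]]; first by exists [::].
have [w tw] : exists w, fp_word [:: t] = gen_prod e w.
  case: t => [a|b].
    have [w ->] := gen1 a; exists (map inl w).
    by elim: w => //= s w <-; rewrite wl.
  have [w ->] := gen2 b; exists (map inr w).
  by elim: w => //= s w <-; rewrite wr.
by exists (w ++ v); rewrite gen_prod_cat -tw -IH -fp_wordM.
Qed.

(** A subgroup of index [n] is the stabilizer of a point of ['I_n], and can be
    read off from this point and from the action of the generators on ['I_n];
    there are countably many such data. *)
Lemma fin_generated_Hfi_countable (G : groupType) : fin_generated G ->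
  exists Hs : nat -> set G, forall H, Hfi G H -> exists i, Hs i = H.
Proof.
move=> [S [e gen]].
pose code := {n : nat & ('I_n * {ffun S -> {ffun 'I_n -> 'I_n}})%type}.
pose decode (c : code) : set G :=
  [set g | exists2 u, g = gen_prod e u &
     foldl (fun x s => (tagged c).2 s x) (tagged c).1 u = (tagged c).1].
exists (fun i => match (choice.unpickle i : option code) with
  Some c => decode c | None => set0 end) => H [[sH _] [n iH]].
have [act [c [[a1 aM] _ st]]] := coset_action sH iH.
pose k : code := Tagged (fun n => ('I_n * {ffun S -> {ffun 'I_n -> 'I_n}})%type)
  (c, [ffun s => [ffun x => act x (e s)]]).
exists (choice.pickle k); rewrite choice.pickleK /decode /=.
have foldE u x :
    foldl (fun x s => [ffun s => [ffun x => act x (e s)]] s x) x u =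
    act x (gen_prod e u).
  by elim: u x => [|s u IH] x /=; rewrite ?a1 // IH !ffunE aM.
apply/seteqP; split=> g /=.
  by move=> [u ->]; rewrite foldE => /st.
by move=> /st gc; have [u gu] := gen g; exists u; rewrite // foldE -gu.
Qed.

End Generation.

(** * The complexes of cosets of finite index subgroups *)

Section FiniteIndexComplexes.
Variable G : groupType.
Local Open Scope group_scope.

Lemma Pfi_neqT C : Pfi G C -> C <> [set: G].
Proof.
move=> [H [[sH HT] _] [g _ <-]] gT; apply: HT; apply/seteqP; split=> // h _.
have : right_coset H g (h * g) by rewrite gT.
by move=> /right_cosetP -/(_ sH); rewrite mulgK.
Qed.

Lemma PfiP C g : Pfi G C -> C g -> exists2 H, Hfi G H & C = right_coset H g.
Proof.
move=> [H Hf [h _ <-]] /right_cosetP hg; exists H => //; have [[sH _] _] := Hf.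
apply/right_coset_eq => //; rewrite -invgF; apply: subgroup_inv => //.
exact: hg.
Qed.

(** Cosets with a common point [g] are of the form [H g], and their intersection
    is the coset of the intersection of the subgroups. *)
Lemma Pfi_bigcap s : nerve_simplex (Hfi G) s -> Pfi G (\bigcap_(C in s) C).
Proof.
move=> [/finite_seqP[l ->] [C0 sC0] sP [g sg]].
pose L := [set h | forall C, C \in l -> C (h * g)].
have fL : finite_index L.
  have {sC0} : {in l, forall C, Pfi G C /\ C g}.
    by move=> C Cl; split; [exact: sP|exact: sg].
  rewrite /L; elim: l {sP sg L} => [|C l IH] lP.
    rewrite (_ : [set h | _] = [set: G]); first exact: finite_indexT.
    by apply/seteqP; split.
  have [PC Cg] := lP C (mem_head _ _).
  have [H /HfiP[fH _] CE] := PfiP PC Cg.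
  rewrite (_ : [set h | _] = H `&` [set h | forall C, C \in l -> C (h * g)]).
    apply: finite_indexI => //; apply: IH => D Dl.
    by apply: lP; rewrite inE Dl orbT.
  have HE h : H h <-> C (h * g).
    by rewrite CE right_cosetP ?mulgK //; case: fH.
  apply/seteqP; split=> h /=.
    move=> Hh; split; first by apply/HE; apply: Hh; exact: mem_head.
    by move=> D Dl; apply: Hh; rewrite inE Dl orbT.
  by move=> [/HE Ch lh] D; rewrite inE => /orP[/eqP->|/lh].
exists L.
  apply/HfiP; split=> // LT; apply: (Pfi_neqT (sP _ sC0)).
  apply/seteqP; split=> // x _.
  have : L (x * g^-1) by rewrite LT.
  by move=> /(_ C0 sC0); rewrite mulgVK.
exists g => //; apply/seteqP; split=> x.
  by move=> /right_cosetP -/(_ fL.1) Lx C /Lx; rewrite mulgVK.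
by move=> sx; apply/right_cosetP; [exact: fL.1|move=> C /sx; rewrite mulgVK].
Qed.

(** The least coset of the chain provides a common point. *)
Lemma Pfi_chain_nerve : order_simplex subset (Pfi G) `<=` nerve_simplex (Hfi G).
Proof.
move=> s [/finite_seqP[l ->] [C0 sC0] sP tot].
split=> //; [exact: finite_seq|by exists C0|].
have [D Dl HD] := chain_min sC0 tot.
have [H [[sH _] _] [g _ gD]] := sP _ Dl.
by exists g => C /HD; apply; rewrite -gD; exact: right_coset_refl.
Qed.

Hypothesis G_fg : fin_generated G.
Hypothesis G_compl : forall M, finite_index M ->
  exists2 K, Hfi G K & forall g, exists2 x, K x & right_coset M g x.

(** [M k] and [K (M k)] form the sequences of subgroups from which the levels
    and the apices of the cones are obtained. *)
Lemma nerve_finitary_contraction (R : realType) :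
  exists (F : realization R (nerve_complex (Hfi G)) -> R -> _) x0,
    finitary_contraction F x0.
Proof.
have [Hs HsP] := fin_generated_Hfi_countable G_fg.
have /choice[K KP] : forall M, exists K, finite_index M ->
    Hfi G K /\ forall g, exists2 x, K x & right_coset M g x.
  move=> M; have [fM|nM] := pselect (finite_index M); last by exists set0.
  by have [K KH Kg] := G_compl fM; exists K.
pose next i M :=
  M `&` K M `&` (if `[< Hfi G (Hs i) >] then Hs i else [set: G]).
pose M := fix M k := if k is k'.+1 then next k' (M k') else [set: G].
have fM k : finite_index (M k).
  elim: k => [|k IH]; first exact: finite_indexT.
  rewrite /= /next; apply: finite_indexI.
    apply: finite_indexI => //; exact: (((HfiP _).1 (KP _ IH).1).1).
  by case: asboolP => [/HfiP[]//|_]; exact: finite_indexT.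
have Mdecr i j : (i <= j)%N -> M j `<=` M i.
  move=> /subnKC <-; elim: (j - i)%N => [|k IH]; rewrite ?addn0 // addnS.
  by move=> g [[/IH]].
(* [C] is a union of right cosets of [M k]. *)
pose sat (C : set G) k : Prop :=
  forall m x, M k m -> C x -> C (m * x).
have sat_decr (C : set G) i j : (i <= j)%N -> sat C i -> sat C j.
  by move=> ij Ci m x /(Mdecr _ _ ij); exact: Ci.
have sat_ex C : Pfi G C -> exists k, `[< sat C k >].
  move=> [H Hf [g _ <-]]; have [i iH] := HsP H Hf; exists i.+1; apply/asboolP.
  move=> m x [_]; rewrite iH asboolT //= => Hm.
  have [[sH _] _] := Hf.
  move=> /right_cosetP -/(_ sH) Hx; apply/right_cosetP => //.
  by rewrite -mulgA; exact: subgroup_mul.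
pose lev (C : set G) :=
  if pselect (exists k, `[< sat C k >]) is left e then ex_minn e else 0%N.
have levP C k : Pfi G C -> (lev C <= k)%N -> sat C k.
  rewrite /lev => /sat_ex e; case: pselect => // e'; case: ex_minnP => m.
  by move=> /asboolP sm _ mk; exact: sat_decr sm.
have lev_le C k : sat C k -> (lev C <= k)%N.
  rewrite /lev; case: pselect => // e; case: ex_minnP => m _ mm sk.
  by apply: mm; apply/asboolP.
have KH k : Hfi G (K (M k)) by exact: (KP _ (fM k)).1.
have KPfi k : Pfi G (K (M k)).
  exists (K (M k)); first exact: KH.
  exists 1 => //; apply/seteqP; have [[sK _] _] := KH k.
  split=> x; first by move=> /right_cosetP -/(_ sK); rewrite invg1 mulg1.
  by move=> Kx; apply/right_cosetP => //; rewrite invg1 mulg1.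
pose v k := K (M k).
have lev_v k : (lev (v k) <= k.+1)%N.
  apply: lev_le => m x [[_ Km] _] Kx.
  by have [[sK _] _] := KH k; exact: subgroup_mul.
have simplex_v0 : simplex (nerve_complex (Hfi G)) [set v 0%N].
  split; [exact: finite_set1|by exists (v 0%N)|by move=> _ ->; exact: KPfi|].
  by exists 1 => _ ->; have [[[K1 _] _] _] := KH 0%N.
have cone k s : simplex (nerve_complex (Hfi G)) s ->
    (forall w, s w -> (lev w <= k)%N) ->
    simplex (nerve_complex (Hfi G)) (s `|` [set v k]).
  move=> [sfin [C0 sC0] sP [g sg]] slev.
  (* The whole coset of [g] lies in each vertex of [s]; move [g] into [K]. *)
  have [x Kx Mx] := (KP _ (fM k)).2 g.
  split.
  - by rewrite finite_setU; split=> //; exact: finite_set1.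
  - by exists C0; left.
  - by move=> C [/sP//|->]; exact: KPfi.
  - exists x => C [sC|->] //.
    have [m Mm <-] := Mx.
    by apply: (levP C k (sP _ sC) (slev _ sC)) => //; exact: sg.
by do 2 eexists; exact: (flow_contraction R cone lev_v simplex_v0).
Qed.

End FiniteIndexComplexes.

(** * Contractibility for free products *)

Theorem theorem6p2 (R : realType) (X1 X2 : finType)
  (R1 : set (signed_word X1)) (R2 : set (signed_word X2))
  (G1 G2 : groupType)
  (pres1 : group_iso G1 (presented_group R1))
  (pres2 : group_iso G2 (presented_group R2))
  (H1 : set G1) (H2 : set G2) (w1 : G1) (w2 : G2) (n1 n2 : nat)
  (H1_proper : proper_subgroup H1) (H2_proper : proper_subgroup H2)
  (H1_index : has_index H1 n1) (H2_index : has_index H2 n2)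
  (H1_transversal : right_transversal H1 [set (w1 ^+ k)%g | k in `I_n1])
  (H2_transversal : right_transversal H2 [set (w2 ^+ k)%g | k in `I_n2]) :
  contractible R (realization R (nerve_complex (Hfi (free_product G1 G2)))) /\
  contractible R
    (realization R (order_complex subset (Pfi (free_product G1 G2)))).
Proof.
have H1fi : Hfi G1 H1 by split=> //; exists n1.
have H2fi : Hfi G2 H2 by split=> //; exists n2.
have fg := fp_fin_generated (presented_fin_generated pres1)
  (presented_fin_generated pres2).
have compl M (fM : finite_index M) := fp_coprime_complement H1fi H2fi fM.
have [F [x0 Fx0]] := nerve_finitary_contraction fg compl R.
split; first exact: finitary_contractible Fx0.
apply: finitary_contractible.
exact: (@slide_contraction R (free_product G1 G2) _
  (nerve_complex (Hfi (free_product G1 G2))) (@Pfi_bigcap _) (@Pfi_neqT _)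
  (@Pfi_chain_nerve _) _ _ Fx0).
Qed.
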